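(* Let $d\ge1$ and let $f:\mathbb R^d\to[-1,1]$ be an odd measurable function. For every finitely supported probability distribution $\mathcal D$ on $P$ there is a finitely supported probability distribution $\mathcal D'$ on $P$ with $c(\mathcal D')=c(\mathcal D)$ and $s_3(f,\mathcal D')\le s_3(f,\mathcal D)$ that has one of the following forms: (1) $\mathcal D'$ is supported on $\{(-\rho,-\rho,-\rho),(-\rho,-\rho,1)\}$ for some $\rho\in[0,\tfrac13]$; (2) $\mathcal D'$ is supported on $\{(-\tfrac13,-\tfrac13,-\tfrac13),(-\rho,-\rho,1)\}$ for some $\rho\in[\tfrac13,1]$; (3) $\mathcal D'$ is supported on $\{(-\rho,-\rho,1),(1,1,1)\}$ for some $\rho\in[-1,1]$. (That is, for MAX NAE-$\{3\}$-SAT with any completeness, the hardest distributions of pairwise biases for one-dimensional or multidimensional odd RPR$^2$ rounding are of these forms.)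
   Context: $P\subseteq\mathbb R^3$ is the set of triples $(b_{1,2},b_{1,3},b_{2,3})$ of pairwise biases $\mathbb E[x_1x_2],\mathbb E[x_1x_3],\mathbb E[x_2x_3]$ realizable by some distribution on $(x_1,x_2,x_3)\in\{-1,1\}^3$; equivalently $b_{1,2}+b_{1,3}+b_{2,3}\ge-1$, $b_{1,2}\ge b_{1,3}+b_{2,3}-1$, $b_{1,3}\ge b_{1,2}+b_{2,3}-1$, $b_{2,3}\ge b_{1,2}+b_{1,3}-1$. For a distribution $\mathcal D$ on $P$ (the distribution of the pairwise biases of the clauses of an $\mathrm{NAE}_3$ instance), its completeness is $c(\mathcal D)=\mathbb E_{\mathcal D}\big[\frac{3-b_{1,2}-b_{1,3}-b_{2,3}}{4}\big]$ and the performance of $f$ is $s_3(f,\mathcal D)=\mathbb E_{\mathcal D}\big[\frac{3-F_2[f](b_{1,2})-F_2[f](b_{1,3})-F_2[f](b_{2,3})}{4}\big]$. Here $F_2[f](\rho)=\mathbb E[f(\mathbf g)f(\mathbf h)]$ where $\mathbf g,\mathbf h$ are $d$-dimensional standard Gaussian vectors with $\mathbb E[g_ih_j]=\rho\,\delta_{ij}$ (i.e. $\rho$-correlated), which equals $\mathbb E[X_1X_2]$ for the RPR$^2$ rounding with $f$ of two unit vectors with inner product $\rho$. *)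

(* Defs.v *)
From HB Require Import structures.
From mathcomp Require Import all_boot all_order all_algebra.
From mathcomp Require Import all_classical all_reals all_analysis.
Set Implicit Arguments. Unset Strict Implicit. Unset Printing Implicit Defensive.
Import Order.TTheory GRing.Theory Num.Theory.
Local Open Scope ring_scope.
Local Open Scope classical_set_scope.

Section Defs.
Variable R : realType.

(* E[phi(g)] for g a standard Gaussian vector in R^n (R^n = n.-tuple R with
   its product sigma-algebra), as the iterated integral over the n
   independent standard normal coordinates. *)
Fixpoint gauss_exp (n : nat) : (n.-tuple R -> R) -> R :=
  match n return (n.-tuple R -> R) -> R with
  | 0 => fun phi => phi [tuple]
  | n'.+1 => fun phi =>
      Rintegral (normal_prob (0:R) 1) setT
        (fun x : R => gauss_exp (fun t : n'.-tuple R => phi [tuple of x :: t]))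
  end.

Definition corr_vec (d : nat) (rho : R) (g z : d.-tuple R) : d.-tuple R :=
  [tuple rho * tnth g i + Num.sqrt (1 - rho ^+ 2) * tnth z i | i < d].

(* F_2[f](rho) = E[f(g) f(h)] with g, h rho-correlated standard Gaussian
   vectors; realized as h = rho g + sqrt(1-rho^2) z with z independent of g. *)
Definition F2 (d : nat) (f : d.-tuple R -> R) (rho : R) : R :=
  gauss_exp (fun g : d.-tuple R =>
    gauss_exp (fun z : d.-tuple R => f g * f (corr_vec rho g z))).

Definition bias := (R * R * R)%type.

Definition inP (b : bias) : Prop :=
  let '(b12, b13, b23) := b in
  [/\ b12 + b13 + b23 >= -1, b12 >= b13 + b23 - 1,
      b13 >= b12 + b23 - 1 & b23 >= b12 + b13 - 1].

Definition fdist := seq (R * bias).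

Definition is_fdist_on_P (D : fdist) : Prop :=
  (forall x, x \in D -> 0 <= x.1 /\ inP x.2) /\ \sum_(x <- D) x.1 = 1.

Definition fexp (D : fdist) (phi : bias -> R) : R :=
  \sum_(x <- D) x.1 * phi x.2.

Definition supported_on (D : fdist) (S : bias -> Prop) : Prop :=
  forall x, x \in D -> 0 < x.1 -> S x.2.

Definition completeness (D : fdist) : R :=
  fexp D (fun b => let '(b12, b13, b23) := b in (3 - b12 - b13 - b23) / 4).

Definition s3 (d : nat) (f : d.-tuple R -> R) (D : fdist) : R :=
  fexp D (fun b => let '(b12, b13, b23) := b in
     (3 - F2 f b12 - F2 f b13 - F2 f b23) / 4).

Definition odd_fun (d : nat) (f : d.-tuple R -> R) : Prop :=
  forall x : d.-tuple R, f (map_tuple (fun y => - y) x) = - f x.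

End Defs.

(* Main.v *)
Require Import Defs.
From HB Require Import structures.
From mathcomp Require Import all_boot all_order all_algebra.
From mathcomp Require Import all_classical all_reals all_analysis measurable_realfun.
From mathcomp Require Import ring lra.
Import Order.TTheory GRing.Theory Num.Theory.
Import numFieldNormedType.Exports.
Local Open Scope ring_scope.
Local Open Scope classical_set_scope.

(* F = F2 f is odd, and it is convex on [0, 1].  The latter is proved without
   Hermite expansions: by rotation invariance F(a b) = E[(P_a f)(P_b f)] with
   P_a f (x) = E f(a x + sqrt(1 - a^2) z), so Cauchy-Schwarz gives
   F(a b)^2 <= F(a^2) F(b^2); oddness of f and the total-variation distance of
   shifted Gaussians give F(x) = O(x), which iterating the former inequality
   improves to F(x y) <= x F(y).  Hence F(x)/x is nondecreasing and
   multiplicatively midpoint-convex, so F satisfies the chord inequality on every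
   geometric grid, and the grids can be refined.
   By convexity every point of P is dominated (same sum of biases, larger sum of
   F-values) by a mixture of points (-a, -a, -a) with a <= 1/3, points (-b, -b, 1)
   with b >= 0, and (1, 1, 1); points of the same kind merge by Jensen's
   inequality.  As 2 (-a, -a, -a) + (1, 1, 1) and 3 (-a, -a, 1) have the same
   multiset of coordinates, either the points (-a, -a, -a) or the point (1, 1, 1)
   can be eliminated, and a last averaging of a and b yields the three forms. *)

(** * Convexity from multiplicative convexity *)

(** The chord inequality with denominators cleared, so that degenerate intervals need no side
    condition. *)
Definition convex01 {R : realFieldType} (F : R -> R) :=
  forall x z y, 0 <= x -> x <= z -> z <= y -> y <= 1 ->
  (y - x) * F z <= (y - z) * F x + (z - x) * F y.

Section Convexity.
Context {R : realType}.
Variable F : R -> R.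

Hypothesis F_ge0 : forall x, 0 <= x <= 1 -> 0 <= F x.
Hypothesis F_mul : forall a b, 0 <= a <= 1 -> 0 <= b <= 1 ->
  F (a * b) ^+ 2 <= F (a ^+ 2) * F (b ^+ 2).
Variable K : R.
Hypothesis F_lin : forall x, 0 <= x <= 1 -> F x <= K * x.

(** If the ratio [q] of the two sides exceeded 1, [F_mul] would square it each time [rho] is
    squared, whereas [F_lin] keeps all these ratios below [K / F tau]. *)
Lemma sub_linear (rho tau : R) : 0 <= rho <= 1 -> 0 <= tau <= 1 ->
  F (rho * tau) <= rho * F tau.
Proof.
move=> r01 t01; have /andP[r0 r1] := r01; have /andP[t0 t1] := t01.
(* [F_mul] at [x * sqrt tau] and [sqrt tau]. *)
have step x : 0 <= x <= 1 -> F (x * tau) ^+ 2 <= F (x ^+ 2 * tau) * F tau.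
  move=> /andP[x0 x1].
  have s0 : 0 <= Num.sqrt tau <= 1.
    by rewrite sqrtr_ge0/= -sqrtr1 ler_sqrt.
  have /andP[s00 s01] := s0.
  have := F_mul (x * Num.sqrt tau) (Num.sqrt tau).
  rewrite -mulrA -expr2 exprMn sqr_sqrtr//; apply => //.
  by rewrite mulr_ge0//= mulr_ile1.
have [Ft0|Ftn0] := eqVneq (F tau) 0.
  rewrite Ft0 mulr0; have := step rho r01; rewrite Ft0 mulr0 => h.
  by have := sqr_ge0 (F (rho * tau)); move: h; nra.
have Ftp : 0 < F tau by rewrite lt_neqAle eq_sym Ftn0 F_ge0.
rewrite leNgt; apply/negP => bad.
have r_gt0 : 0 < rho.
  rewrite lt_neqAle r0 andbT; apply/negP => /eqP r00; move: bad.
  by rewrite -r00 !mul0r ltNge (le_trans (F_lin 0 _))// ?lexx ?ler01// mulr0.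
pose q := F (rho * tau) / F tau / rho.
have q1 : 1 < q by rewrite /q ltr_pdivlMr// ltr_pdivlMr// mul1r.
have iter n : (q * rho) ^+ (2 ^ n) <= F (rho ^+ (2 ^ n) * tau) / F tau.
  elim: n => [|n IH].
    by rewrite expn0 !expr1 /q divfK// gt_eqF.
  rewrite expnSr !exprM.
  have e01 : 0 <= rho ^+ (2 ^ n) <= 1 by rewrite exprn_ge0//= exprn_ile1.
  have := step _ e01 => st.
  have IH0 : 0 <= (q * rho) ^+ (2 ^ n).
    by rewrite exprn_ge0// mulr_ge0// ltW// (lt_trans ltr01).
  apply: (@le_trans _ _ ((F (rho ^+ (2 ^ n) * tau) / F tau) ^+ 2)).
    by rewrite ler_sqr// nnegrE// (le_trans IH0).
  rewrite ler_pdivlMr// exprMn exprVn -(ler_pM2r Ftp).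
  rewrite (_ : _ * _ * _ = F (rho ^+ (2 ^ n) * tau) ^+ 2)//; field.
  by rewrite gt_eqF.
have bound n : q ^+ (2 ^ n) <= K / F tau.
  have e0 : 0 < rho ^+ (2 ^ n) by rewrite exprn_gt0.
  have e1 : rho ^+ (2 ^ n) <= 1 by rewrite exprn_ile1.
  rewrite -(ler_pM2r e0) -exprMn (le_trans (iter n))//.
  rewrite mulrAC ler_pM2r ?invr_gt0//.
  apply: (le_trans (F_lin (rho ^+ (2 ^ n) * tau) _)).
    by apply/andP; split; [exact: mulr_ge0 (ltW e0) t0|exact: mulr_ile1 (ltW e0) t0 e1 t1].
  have K0 : 0 <= K.
    have := F_lin 1; have := F_ge0 1; rewrite ler01 lexx mulr1.
    by move=> /(_ isT) h /(_ isT); exact: le_trans.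
  by rewrite mulrA ler_piMr// mulr_ge0// ltW.
(* Bernoulli's inequality: the powers of [q] are unbounded. *)
have big n : 1 + n%:R * (q - 1) <= q ^+ n.
  elim: n => [|n IH]; first by rewrite mul0r addr0 expr0.
  rewrite exprS; apply: (@le_trans _ _ (q * (1 + n%:R * (q - 1)))).
    have : 0 <= n%:R * (q - 1) ^+ 2 :> R by rewrite mulr_ge0 ?sqr_ge0.
    by rewrite -[n.+1%:R]natr1 expr2; lra.
  by rewrite ler_pM2l// (lt_trans ltr01).
have qp : 0 < q - 1 by rewrite subr_gt0.
have [m hm] : exists m : nat, K / F tau / (q - 1) < m%:R.
  exists (Num.truncn (K / F tau / (q - 1))).+1; exact: truncnS_gt.
move: hm; rewrite ltr_pdivrMr// => hm.
have := bound m; apply/negP; rewrite -ltNge.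
apply: (lt_le_trans hm).
apply: (@le_trans _ _ (q ^+ m)); first by have := big m; lra.
by rewrite ler_eXn2l// ltnW// ltn_expl.
Qed.

(** The gaps of [x / r], [x], [x * r] have ratio [1 : r], so this is monotonicity of the two slopes.
    It follows from the AM-GM form of [F_mul] ([h6]) together with [sub_linear] ([h1']). *)
Lemma three_point (x r : R) : 0 < x -> 1 <= r -> x * r <= 1 ->
  r * (F x - F (x / r)) <= F (x * r) - F x.
Proof.
move=> x0 r1 xr1.
have r0 : 0 < r by lra.
have x1 : x <= 1 by nra.
have xr0 : 0 < x / r by rewrite divr_gt0.
have ir1 : r^-1 <= 1 by rewrite invf_le1.
have ir0 : 0 < r^-1 by rewrite invr_gt0.
have h1 : F (x / r) <= r^-1 * F x.
  by rewrite mulrC; apply: sub_linear; apply/andP; split => //; exact: ltW.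
have xr1' : 0 <= x * r by rewrite mulr_ge0 ?(ltW x0) ?(ltW r0).
have h2 : F x ^+ 2 <= F (x / r) * F (x * r).
  have e : Num.sqrt (x / r) * Num.sqrt (x * r) = x.
    rewrite -sqrtrM; last exact: ltW.
    have -> : x / r * (x * r) = x ^+ 2 by field; rewrite gt_eqF.
    by rewrite sqrtr_sqr gtr0_norm.
  have := F_mul (Num.sqrt (x / r)) (Num.sqrt (x * r)).
  rewrite e.
  rewrite (sqr_sqrtr (ltW xr0)) (sqr_sqrtr xr1').
  by apply; rewrite sqrtr_ge0/= -sqrtr1 ler_sqrt// mulr_ile1 ?(ltW x0) ?(ltW ir0).
have h3 : 0 <= F (x / r).
  by apply: F_ge0; rewrite ltW//= mulr_ile1// ltW.
have h4 : 0 <= F x by apply: F_ge0; rewrite ltW.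
have h5 : 0 <= F (x * r) by apply: F_ge0; rewrite mulr_ge0// ltW.
have h1' : r * F (x / r) <= F x.
  have := ler_wpM2l (ltW r0) h1; rewrite mulrA divff ?mul1r// gt_eqF//.
set A := F (x / r) in h1' h2 h3 *; set g := F x in h1' h2 h4 *.
set B := F (x * r) in h2 h5 *.
have h6 : 2 * r * g <= r ^+ 2 * A + B.
  have : (2 * r * g) ^+ 2 <= (r ^+ 2 * A + B) ^+ 2.
    have : 0 <= (r ^+ 2 * A - B) ^+ 2 by exact: sqr_ge0.
    have : r ^+ 2 * g ^+ 2 <= r ^+ 2 * (A * B).
      by rewrite ler_wpM2l// sqr_ge0.
    by rewrite !expr2; lra.
  rewrite ler_sqr// nnegrE.
    by rewrite !mulr_ge0// ltW.
  by rewrite addr_ge0// mulr_ge0// sqr_ge0.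
have : r * (r - 1) * A <= (r - 1) * g.
  by rewrite mulrAC mulrC ler_wpM2l//; lra.
by move: h6; rewrite expr2; lra.
Qed.

(** On the grid [x * r ^+ k] the slope of step [k] is proportional to [D k / r ^+ k], which is
    nondecreasing by [three_point]. The slope of step [j] thus separates the mean slopes before and
    after the grid point [j]. *)
Lemma grid_chord (x r : R) (j n : nat) : 0 < x -> 1 < r -> (j <= n)%N ->
  x * r ^+ n <= 1 ->
  (r ^+ n - 1) * F (x * r ^+ j) <=
    (r ^+ n - r ^+ j) * F x + (r ^+ j - 1) * F (x * r ^+ n).
Proof.
move=> x0 r1 jn xrn.
have r0 : 0 < r by lra.
have rn0 k : 0 < r ^+ k by rewrite exprn_gt0.
pose u k := F (x * r ^+ k); pose D k := u k.+1 - u k.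
have step k : (k.+2 <= n)%N -> r * D k <= D k.+1.
  move=> kn; rewrite /D /u.
  have := three_point (x * r ^+ k.+1) r.
  rewrite (_ : x * r ^+ k.+1 / r = x * r ^+ k); last first.
    by rewrite exprS; field; rewrite gt_eqF.
  rewrite -mulrA -exprSr; apply => //.
  - by rewrite mulr_gt0.
  - exact: ltW.
  - apply: le_trans xrn; rewrite ler_pM2l// ler_eXn2l//.
have [->|jn'] := eqVneq j n; first by rewrite subrr mul0r add0r.
have {jn'}jn : (j < n)%N by rewrite ltn_neqAle jn'.
(* The mean slope over the first [k] steps is at most the slope of step [k]. *)
have A k : (k < n)%N -> (r - 1) * r ^+ k * (u k - u 0%N) <= D k * (r ^+ k - 1).
  elim: k => [|k IH] kn; first by rewrite expr0 !subrr !mulr0.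
  have := IH (ltnW kn).
  have e : u k.+1 = u k + D k by rewrite /D addrC subrK.
  have := step k kn; rewrite e exprS.
  have := rn0 k; set p := r ^+ k; set d := D k; set d' := D k.+1.
  set v := u k; set v0 := u 0%N => p0 sd ih.
  apply: (@le_trans _ _ (r * d * (r * p - 1))).
    have : r * ((r - 1) * p * (v - v0)) <= r * (d * (p - 1)).
      by rewrite ler_pM2l.
    lra.
  apply: ler_wpM2r => //.
  have : 1 <= r ^+ k.+1 by rewrite exprn_ege1// ltW.
  by rewrite exprS -/p; lra.
(* The mean slope from [j] on is at least the slope of step [j]; the second conjunct compares single
   steps and carries the induction. *)
have B m : (j + m < n)%N ->
   D j * (r ^+ (j + m).+1 - r ^+ j) <= (r - 1) * r ^+ j * (u (j + m).+1 - u j)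
   /\ r ^+ (j + m) * D j <= r ^+ j * D (j + m)%N.
  elim: m => [|m IH] mn.
    rewrite addn0; split => //.
    by rewrite exprS -/(D j) /D; lra.
  rewrite addnS in mn *.
  have [i1 i2] := IH (ltnW mn).
  have st := step _ mn.
  have e2 : r ^+ (j + m).+1 * D j <= r ^+ j * D (j + m).+1.
    rewrite exprS.
    apply: (@le_trans _ _ (r ^+ j * (r * D (j + m)%N))).
      have : r * (r ^+ (j + m) * D j) <= r * (r ^+ j * D (j + m)%N).
        by rewrite ler_pM2l.
      lra.
    by rewrite ler_pM2l.
  split => //.
  have e : u (j + m).+2 = u (j + m).+1 + D (j + m).+1.
    by rewrite /D addrC subrK.
  rewrite e [in X in X <= _]exprS.
  have : (r - 1) * (r ^+ (j + m).+1 * D j) <= (r - 1) * (r ^+ j * D (j + m).+1).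
    by rewrite ler_pM2l// subr_gt0.
  by lra.
have [m e] : exists m, n = (j + m).+1.
  by exists (n - j.+1)%N; rewrite -addSn subnKC.
have [B1 _] := B m ltac:(by rewrite e).
rewrite -e in B1.
have A1 := A j jn.
have u0 : F x = u 0%N by rewrite /u expr0 mulr1.
rewrite u0 -/(u j) -/(u n).
have rnj : 0 <= r ^+ n - r ^+ j by rewrite subr_ge0 ler_eXn2l// ltnW.
have rj1 : 0 <= r ^+ j - 1 by rewrite subr_ge0 exprn_ege1// ltW.
have p0 : 0 < (r - 1) * r ^+ j by rewrite mulr_gt0// subr_gt0.
have h1 := ler_wpM2r rnj A1.
have h2 := ler_wpM2r rj1 B1.
rewrite -subr_ge0 -(pmulr_rge0 _ p0).
move: h1 h2; move: (D j) (u j) (u n) (u 0%N) (r ^+ n) (r ^+ j).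
by move=> d uj un v0 p q h1 h2; lra.
Qed.

(** A geometric grid starting at [x] is made to hit [z] exactly at index [k]; only [y] has to be
    approximated, by a grid point below it, and the resulting error is [O(1/k)]. *)
Lemma F_convex01 : convex01 F.
Proof.
move=> x z y x0 xz zy y1.
have z0 : 0 <= z := le_trans x0 xz.
have y0 : 0 <= y := le_trans z0 zy.
have sub a b : 0 <= a -> a <= b -> b <= 1 -> b * F a <= a * F b.
  move=> a0 ab b1; have [b0|bn0] := eqVneq b 0.
    have a00 : a = 0 by apply/eqP; rewrite eq_le a0 andbT -b0.
    by rewrite a00 b0 !mul0r.
  have bp : 0 < b by rewrite lt_neqAle eq_sym bn0 (le_trans a0).
  have := sub_linear (a / b) b; rewrite divfK//.
  have -> : 0 <= a / b <= 1 by rewrite divr_ge0 ?(ltW bp)//= ler_pdivrMr// mul1r.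
  rewrite (ltW bp) b1 => /(_ isT isT).
  by rewrite mulrAC ler_pdivlMr// mulrC.
(* No geometric grid starts at 0; there the chord inequality is the monotonicity of [F t / t], that
   is [sub]. *)
have [x00|xn0] := eqVneq x 0.
  have F0 : F 0 <= 0.
    by have := F_lin 0; rewrite lexx ler01 mulr0; exact.
  have F0' : 0 <= F 0 by apply: F_ge0; rewrite lexx ler01.
  have F00 : F 0 = 0 by apply/eqP; rewrite eq_le F0 F0'.
  by have := sub _ _ z0 zy y1; rewrite x00 F00 !subr0 mulr0 add0r.
have xp : 0 < x by rewrite lt_neqAle eq_sym xn0.
have [->|xz'] := eqVneq x z; first by rewrite subrr mul0r addr0.
have {}xz' : x < z by rewrite lt_neqAle xz'.
have zp : 0 < z by exact: lt_trans xz'.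
have yp : 0 < y by exact: lt_le_trans zy.
have Fx0 : 0 <= F x by apply: F_ge0; rewrite x0 (le_trans xz)// (le_trans zy).
have Fz0 : 0 <= F z by apply: F_ge0; rewrite z0 (le_trans zy).
set RHS := (X in _ <= X).
have key k : (0 < k)%N ->
    (y - x) * F z - RHS <= y * (z / x - 1) * F z / k%:R.
  move=> k0; have k0' : 0 < k%:R :> R by rewrite ltr0n.
  have zx : 1 < z / x by rewrite ltr_pdivlMr// mul1r.
  pose r := expR (ln (z / x) / k%:R).
  have rk : r ^+ k = z / x.
    rewrite -expRM_natl mulrC divfK ?gt_eqF// lnK// posrE.
    by rewrite (lt_trans ltr01).
  have r1 : 1 < r by rewrite expR_gt1 divr_gt0// ln_gt0.
  have r0 : 0 < r := lt_trans ltr01 r1.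
  have big n : 1 + n%:R * (r - 1) <= r ^+ n.
    elim: n => [|n IH]; first by rewrite mul0r addr0 expr0.
    rewrite exprS; apply: (@le_trans _ _ (r * (1 + n%:R * (r - 1)))).
      have : 0 <= n%:R * (r - 1) ^+ 2 :> R by rewrite mulr_ge0 ?sqr_ge0.
      by rewrite -[n.+1%:R]natr1 expr2; lra.
    by rewrite ler_pM2l.
  (* Bernoulli bounds the number of grid points up to [y], so a last one [y'] exists. *)
  have ubn n : (x * r ^+ n <= y) -> (n <= (Num.truncn (y / x / (r - 1))).+1)%N.
    move=> h; rewrite -(ler_nat R) ltW//; apply: le_lt_trans (truncnS_gt _).
    rewrite ler_pdivlMr ?subr_gt0// ler_pdivlMr// mulrC.
    apply: le_trans h; rewrite ler_pM2l//.
    by have := big n; lra.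
  have exn : exists n, x * r ^+ n <= y by exists 0%N; rewrite expr0 mulr1 (le_trans xz).
  case: (ex_maxnP exn ubn) => n yn nmax.
  have ynS : y < x * r ^+ n.+1.
    by rewrite ltNge; apply/negP => /nmax; rewrite ltnn.
  have kn : (k <= n)%N by apply: nmax; rewrite rk mulrC divfK ?gt_eqF.
  have := grid_chord x r k n xp r1 kn (le_trans yn y1).
  rewrite rk (_ : x * (z / x) = z); last by rewrite mulrC divfK ?gt_eqF.
  set y' := x * r ^+ n in yn *.
  have y'E : r ^+ n = y' / x by rewrite /y' mulrAC divff ?gt_eqF// mul1r.
  rewrite y'E => /(ler_wpM2l x0).
  have -> : x * ((y' / x - 1) * F z) = (y' - x) * F z by field; rewrite gt_eqF.
  have -> : x * ((y' / x - z / x) * F x + (z / x - 1) * F y') =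
     (y' - z) * F x + (z - x) * F y' by field; rewrite gt_eqF.
  have y'0 : 0 < y' by rewrite mulr_gt0// exprn_gt0.
  have Fyy : F y' <= F y.
    have h := sub _ _ (ltW y'0) yn y1; rewrite -(ler_pM2l yp) (le_trans h)//.
    by rewrite ler_wpM2r// F_ge0// y0.
  have yr : y <= y' * r by move: ynS; rewrite exprSr mulrA => /ltW.
  move=> ch.
  have rle : k%:R * (r - 1) <= z / x - 1 by have := big k; rewrite rk; lra.
  (* The next grid point [y' * r] passes [y], and [k * (r - 1) <= z / x - 1] by Bernoulli. *)
  have yy' : y - y' <= y * (z / x - 1) / k%:R.
    rewrite ler_pdivlMr//.
    apply: (@le_trans _ _ (y' * (r - 1) * k%:R)).
      by rewrite ler_wpM2r ?(ltW k0')//; lra.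
    rewrite -mulrA ler_pM// ?(ltW y'0)//; first by rewrite mulr_ge0 ?(ltW k0')// subr_ge0 ltW.
    by rewrite mulrC.
  have h1 : (y' - z) * F x <= (y - z) * F x by rewrite ler_wpM2r//; lra.
  have h2 : (z - x) * F y' <= (z - x) * F y by rewrite ler_wpM2l//; lra.
  have h3 := ler_wpM2r Fz0 yy'.
  rewrite [leRHS]mulrAC /RHS.
  by move: h1 h2 h3 ch; lra.
(* A positive defect [e] contradicts [key] as soon as [k > C / e]. *)
rewrite -subr_le0 leNgt; apply/negP => bad.
set e := (y - x) * F z - RHS in bad key.
set C := y * (z / x - 1) * F z in key.
pose k := (Num.truncn (C / e)).+1.
have := key k isT; rewrite ler_pdivlMr ?ltr0n//; apply/negP; rewrite -ltNge.
by rewrite mulrC -ltr_pdivrMr// truncnS_gt.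
Qed.

End Convexity.

(** * Reduction of bias distributions *)

Section Reduction.
Context {R : realFieldType}.
Variable F : R -> R.
Hypothesis Fcvx : convex01 F.
Hypothesis Fodd : forall x, -1 <= x <= 1 -> F (- x) = - F x.

Let F0 : F 0 = 0.
Proof.
have := Fodd 0; rewrite oppr0 => /(_ ltac:(by rewrite ler01 andbT lerN10)).
by move=> ?; lra.
Qed.

Lemma convex_chord0 (x y : R) : 0 <= x -> x <= y -> y <= 1 ->
  y * F x <= x * F y.
Proof.
by move=> x0 xy y1; have := Fcvx 0 x y (lexx _) x0 xy y1; rewrite F0; lra.
Qed.

(** The witness is the weighted mean. Both relations are multiplied by [p + q] so that zero total
    weight is allowed, and the bound [c] is kept so that a merged point retains its range. *)
Lemma jensen2 (p q x y c : R) : 0 <= p -> 0 <= q -> 0 <= x <= c ->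
  0 <= y <= c -> c <= 1 ->
  exists m, [/\ 0 <= m <= c, (p + q) * m = p * x + q * y &
    (p + q) * F m <= p * F x + q * F y].
Proof.
wlog xy : p q x y / x <= y.
  move=> wl p0 q0 xc yc c1; have [xy|/ltW yx] := lerP x y.
    exact: wl.
  have [m [m1 m2 m3]] := wl q p y x yx q0 p0 yc xc c1.
  by exists m; split=> //; rewrite addrC ?m2//; lra.
move=> p0 q0 /andP[x0 xc] /andP[y0 yc] c1.
have [pq0|pqn0] := eqVneq (p + q) 0.
  have p00 : p = 0 by lra.
  have q00 : q = 0 by lra.
  by exists x; split; rewrite ?x0 ?p00 ?q00//; lra.
have pq : 0 < p + q by rewrite lt_neqAle eq_sym pqn0 addr_ge0.
pose m := (p * x + q * y) / (p + q).
have em : (p + q) * m = p * x + q * y by rewrite mulrC divfK.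
have xm : x <= m by rewrite ler_pdivlMr//; nra.
have my : m <= y by rewrite ler_pdivrMr//; nra.
exists m; split => //; first by rewrite (le_trans x0 xm) (le_trans my).
have := Fcvx x m y x0 xm my (le_trans yc c1).
have [xy'|xy'] := eqVneq x y.
  have <- : x = m by lra.
  by rewrite -xy' => _; lra.
have yx : 0 < y - x by rewrite subr_gt0 lt_neqAle xy'.
have e1 : (p + q) * (y - m) = p * (y - x) by rewrite mulrBr em; lra.
have e2 : (p + q) * (m - x) = q * (y - x) by rewrite mulrBr em; lra.
move=> /(ler_wpM2l (ltW pq)); rewrite mulrDr !mulrA e1 e2 => h.
by rewrite -(ler_pM2l yx); lra.
Qed.

(** Moving the masses [p] and [q] from inner points to the ends [a] and [k] with fixed barycentre
    raises a convex average: the two chord bounds are added, and the barycentre equation combines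
    their coefficients. *)
Lemma spread2 (p q a c b k : R) : 0 <= p -> 0 <= q -> 0 <= a -> k <= 1 ->
  a <= c -> c <= k -> a <= b -> b <= k -> p * c + q * b = p * a + q * k ->
  p * F c + q * F b <= p * F a + q * F k.
Proof.
move=> p0 q0 a0 k1 ac ck ab bk e.
have [ka|ka] := eqVneq a k.
  have -> : c = k by apply/eqP; rewrite eq_le ck -ka.
  have -> : b = k by apply/eqP; rewrite eq_le bk -ka.
  by rewrite ka.
have ka0 : 0 < k - a by rewrite subr_gt0 lt_neqAle ka (le_trans ac).
rewrite -(ler_pM2l ka0).
have := ler_wpM2l p0 (Fcvx a c k a0 ac ck k1).
have := ler_wpM2l q0 (Fcvx a b k a0 ab bk k1).
have -> : q * ((k - b) * F a + (b - a) * F k) =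
    p * (c - a) * F a + (q * (k - a) - p * (c - a)) * F k.
  have <- : q * (k - b) = p * (c - a) by move: e; clear; lra.
  by ring.
by clear; lra.
Qed.

(* The triple (M, S, V) = (mass, sum of the biases, sum of their F-values) is
   compared with the one of the measure giving mass p to (-a,-a,-a), q to
   (-b,-b,1) and r to (1,1,1). *)
Definition dominated (M S V : R) := exists p q r a b : R,
  [/\ [/\ 0 <= p, 0 <= q & 0 <= r], 0 <= a <= 3^-1, 0 <= b <= 1 &
  [/\ p + q + r = M, - (3 * p * a) + q * (1 - 2 * b) + 3 * r = S &
      V <= - (3 * p * F a) + q * (F 1 - 2 * F b) + 3 * r * F 1]].

(** Points of the first and of the second kind merge by [jensen2]; their [F]-values enter with a
    minus sign, so merging only raises the bound on [V]. *)
Lemma dominatedD M S V M' S' V' : dominated M S V -> dominated M' S' V' ->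
  dominated (M + M') (S + S') (V + V').
Proof.
move=> [p [q [r [a [b [[p0 q0 r0] a01 b01 [e1 e2 h]]]]]]].
move=> [p' [q' [r' [a' [b' [[p0' q0' r0'] a01' b01' [e1' e2' h']]]]]]].
have [|m [m1 m2 m3]] := jensen2 p p' a a' 3^-1 p0 p0' a01 a01'; first by lra.
have [|k [k1 k2 k3]] := jensen2 q q' b b' 1 q0 q0' b01 b01'; first by lra.
exists (p + p'), (q + q'), (r + r'), m, k; split=> //.
- by split; lra.
- by split; lra.
Qed.

Lemma dominatedZ w M S V : 0 <= w -> dominated M S V ->
  dominated (w * M) (w * S) (w * V).
Proof.
move=> w0 [p [q [r [a [b [[p0 q0 r0] a01 b01 [e1 e2 h]]]]]]].
exists (w * p), (w * q), (w * r), a, b; split=> //.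
- by rewrite !mulr_ge0.
- split; [by rewrite -e1; ring|by rewrite -e2; ring|].
  by have := ler_wpM2l w0 h; lra.
Qed.

Lemma dominated_weaken M S V V' : V <= V' -> dominated M S V' -> dominated M S V.
Proof.
move=> leV [p [q [r [a [b [h1 h2 h3 [e1 e2 h]]]]]]].
by exists p, q, r, a, b; split=> //; split=> //; exact: le_trans h.
Qed.

(** Mass [w] goes to [(-a,-a,1)] and mass [1 - w] to the point with all coordinates [-2a/3]; the
    latter spreads the sum [-2a] over three coordinates, which helps since [3 F(2a/3) <= 2 F(a)]. *)
Lemma dominated_mix (a w V : R) : 0 <= a <= 2^-1 -> 0 <= w <= 1 ->
  V <= - (2 * F a) + w * F 1 -> dominated 1 (- (2 * a) + w) V.
Proof.
move=> a01 w01; move/dominated_weaken; apply.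
exists (1 - w), w, 0, (2 / 3 * a), a; split; [split|..]; try lra.
have := convex_chord0 (2 / 3 * a) a ltac:(lra) ltac:(lra) ltac:(lra) => h.
have h' : 3 * F (2 / 3 * a) <= 2 * F a.
  have [a0|an0] := eqVneq a 0; first by rewrite a0 mulr0 F0; lra.
  by rewrite -(@ler_pM2l _ a); lra.
split; [lra|lra|].
have : (1 - w) * (3 * F (2 / 3 * a)) <= (1 - w) * (2 * F a).
  by rewrite ler_wpM2l//; lra.
by clear; lra.
Qed.

(** The point [(-a,-a,z)] lies on the segment from [(-a,-a,2a-1)] to [(-a,-a,1)]. The first end has
    sum [-1] and is replaced by [(-1/3,-1/3,-1/3)]. *)
Lemma dominated_two_neg (a z : R) : 2^-1 <= a <= 1 -> 2 * a - 1 <= z <= 1 ->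
  dominated 1 (- (2 * a) + z) (- (2 * F a) + F z).
Proof.
move=> a01 z01.
have [a11|an1] := eqVneq a 1.
  have -> : z = 1 by lra.
  exists 0, 1, 0, 0, 1; rewrite a11.
  by split; [split|..]; try split; lra.
have alt1 : a < 1 by rewrite lt_neqAle an1; case/andP: a01.
pose l := (1 - z) / (2 - 2 * a).
have el : l * (2 - 2 * a) = 1 - z by rewrite divfK//; lra.
have l01 : 0 <= l <= 1.
  by rewrite divr_ge0 ?ler_pdivrMr; lra.
clearbody l.
exists l, (1 - l), 0, 3^-1, a; split; [split|..]; try lra.
split; [lra|lra|].
(* Both arguments lie in [[0, a]], so [F t <= (t / a) F a], and [3 * (1/3) + (2a - 1) = 2a]. *)
have c1 : 3 * F 3^-1 + F (2 * a - 1) <= 2 * F a.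
  have := convex_chord0 3^-1 a ltac:(lra) ltac:(lra) ltac:(lra).
  have := convex_chord0 (2 * a - 1) a ltac:(lra) ltac:(lra) ltac:(lra).
  by move=> ? ?; rewrite -(@ler_pM2l _ a); lra.
have c2 := Fcvx (2 * a - 1) z 1 ltac:(lra) ltac:(lra) ltac:(lra) (lexx _).
have c3 : F z <= l * F (2 * a - 1) + (1 - l) * F 1.
  rewrite -(@ler_pM2l _ (2 - 2 * a)); last by lra.
  have e : (1 - l) * (2 - 2 * a) = z - (2 * a - 1) by lra.
  rewrite (_ : _ * (l * _ + _) = (1 - z) * F (2 * a - 1) +
    (z - (2 * a - 1)) * F 1); last by rewrite -e -el; ring.
  by move: c2; rewrite (_ : 1 - (2 * a - 1) = 2 - 2 * a); last by lra.
have c4 : l * (3 * F 3^-1 + F (2 * a - 1)) <= l * (2 * F a).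
  by rewrite ler_wpM2l//; case/andP: l01.
by clear -c3 c4; lra.
Qed.

(** After sorting the coordinates, the cases are distinguished by the number of negative ones. *)
Lemma dominated_point (x y z : R) :
  [/\ x + y + z >= -1, x >= y + z - 1, y >= x + z - 1 & z >= x + y - 1] ->
  dominated 1 (x + y + z) (F x + F y + F z).
Proof.
have F1z t : 0 <= t <= 1 -> F t <= t * F 1.
  by move=> /andP[t0 t1]; have := convex_chord0 t 1 t0 t1 (lexx _); rewrite mul1r.
wlog xy : x y z / x <= y.
  move=> wl; have [xy|/ltW yx] := lerP x y; first exact: wl.
  move=> [h1 h2 h3 h4]; have := wl y x z yx.
  rewrite (addrC y x) (addrC (F y)); apply; split; lra.
wlog yz : x y z xy / y <= z.
  move=> wl; have [yz|/ltW zy] := lerP y z; first exact: wl.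
  move=> [h1 h2 h3 h4].
  have [xz|/ltW zx] := lerP x z.
    have := wl x z y xz zy; rewrite (_ : x + z + y = x + y + z); last by ring.
    rewrite (_ : F x + F z + F y = F x + F y + F z); last by ring.
    apply; split; lra.
  have := wl z x y zx xy; rewrite (_ : z + x + y = x + y + z); last by ring.
  rewrite (_ : F z + F x + F y = F x + F y + F z); last by ring.
  apply; split; lra.
move=> [h1 h2 h3 h4].
have z1 : z <= 1 by lra.
have x1 : -1 <= x by lra.
(* No negative coordinate: [F t <= t F 1] bounds the value by [F 1] times the sum, which is attained
   by mixing [(0,0,0)] with [(0,0,1)], or [(0,0,1)] with [(1,1,1)]. *)
have [x0|x0] := lerP 0 x.
  have fx := F1z x ltac:(lra); have fy := F1z y ltac:(lra).
  have fz := F1z z ltac:(lra).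
  have [s1|/ltW s1] := lerP (x + y + z) 1.
    exists (1 - (x + y + z)), (x + y + z), 0, 0, 0.
    by rewrite F0; split; [split|..]; try split; lra.
  exists 0, (1 - (x + y + z - 1) / 2), ((x + y + z - 1) / 2), 0, 0.
  by rewrite F0; split; [split|..]; try split; lra.
(* One negative coordinate is split into two equal halves; membership in [P] gives [y + z <= 1], the
   weight for [dominated_mix]. *)
have [y0|y0] := lerP 0 y.
  have fy := F1z y ltac:(lra); have fz := F1z z ltac:(lra).
  rewrite (_ : x + y + z = - (2 * (- x / 2)) + (y + z)); last by field.
  apply: dominated_mix; [lra|lra|].
  have := convex_chord0 (- x / 2) (- x) ltac:(lra) ltac:(lra) ltac:(lra) => h.
  have h' : 2 * F (- x / 2) <= F (- x).
    by rewrite -(@ler_pM2l _ (- x)); lra.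
  by have := Fodd (- x) ltac:(lra); rewrite opprK; lra.
have ox : F x = - F (- x) by have := Fodd (- x) ltac:(lra); rewrite opprK.
have oy : F y = - F (- y) by have := Fodd (- y) ltac:(lra); rewrite opprK.
(* At least two negative coordinates: [x] and [y] are averaged to [-a]. *)
have [|a [a1 a2 a3]] := jensen2 1 1 (- x) (- y) 1 ler01 ler01 ltac:(lra) ltac:(lra).
  by lra.
have [z0|z0] := lerP 0 z.
  have fz := F1z z ltac:(lra).
  have [ah|/ltW ah] := lerP a 2^-1.
    rewrite (_ : x + y + z = - (2 * a) + z); last by lra.
    by apply: dominated_mix; lra.
  rewrite (_ : x + y + z = - (2 * a) + z); last by lra.
  apply: (dominated_weaken _ _ _ (- (2 * F a) + F z)); first by lra.
  by apply: dominated_two_neg; lra.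
have oz : F z = - F (- z) by have := Fodd (- z) ltac:(lra); rewrite opprK.
have oz1 : 0 <= - z <= 1 by lra.
(* All three are negative and averaged to [-m]; [m <= 1/3] because the sum is at least [-1]. *)
have [m [m1 m2 m3]] := jensen2 2 1 a (- z) 1 (ler0n _ _) ler01 a1 oz1 (lexx _).
exists 1, 0, 0, m, 0; split; [split|..]; try lra.
by split; lra.
Qed.

Lemma dominated_two_point (S V : R) : dominated 1 S V ->
  exists p q : R, [/\ 0 <= p, 0 <= q, p + q = 1 &
  [\/ exists rho, [/\ 0 <= rho <= 3^-1,
        - (3 * p * rho) + q * (1 - 2 * rho) = S &
        V <= - (3 * p * F rho) + q * (F 1 - 2 * F rho)],
      exists rho, [/\ 3^-1 <= rho <= 1,
        - p + q * (1 - 2 * rho) = S &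
        V <= - (3 * p * F 3^-1) + q * (F 1 - 2 * F rho)] |
      exists rho, [/\ 0 <= rho <= 1,
        p * (1 - 2 * rho) + 3 * q = S &
        V <= p * (F 1 - 2 * F rho) + 3 * q * F 1]]].
Proof.
move=> [p [q [r [a [b [[p0 q0 r0] a01 b01 [e1 e2 h]]]]]]].
(* All of the mass [p] is paired with mass [p / 2] of [(1,1,1)] and becomes mass [3p/2] at
   [(-a,-a,1)], to be merged with the mass [q]. *)
have [pr|/ltW pr] := lerP p (2 * r).
  have [||m [m1 m2 m3]] := jensen2 (3 / 2 * p) q a b 1 _ q0 _ b01 (lexx _);
    [lra|lra|].
  exists (3 / 2 * p + q), (r - p / 2); split; [lra|lra|lra|].
  by apply: Or33; exists m; split; [lra|lra|lra].
(* Here [(1,1,1)] is used up instead: with mass [2r] of the first kind it becomes mass [3r] at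
   [(-a,-a,1)]. *)
have [||k [k1 k2 k3]] := jensen2 (3 * r) q a b 1 _ q0 _ b01 (lexx _);
  [lra|lra|].
pose P := p - 2 * r; pose Q := q + 3 * r.
have P0 : 0 <= P by rewrite /P; lra.
have Q0 : 0 <= Q by rewrite /Q; lra.
have eS : - (3 * P * a) + Q * (1 - 2 * k) = S by rewrite /P /Q; lra.
have eV : V <= - (3 * P * F a) + Q * (F 1 - 2 * F k) by rewrite /P /Q; lra.
have PQ : P + Q = 1 by rewrite /P /Q; lra.
clearbody P Q.
exists P, Q; split => //.
(* The weights count negative coordinates: [3P] equal [-a], [2Q] equal [-k]. If their mean [m] is at
   most [1/3], both kinds can use it as [rho]. *)
have [|||m [m1 m2 m3]] := jensen2 (3 * P) (2 * Q) a k 1 _ _ _ k1 (lexx _);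
  [lra|lra|lra|].
have [mt|mt] := lerP m 3^-1.
  by apply: Or31; exists m; split; lra.
have Qp : 0 < Q.
  have [Q00|Qn0] := eqVneq Q 0; last by rewrite lt_neqAle eq_sym Qn0.
  have P1 : P = 1 by lra.
  have ma : m = a by move: m2; rewrite Q00 P1; lra.
  exfalso; move: mt a01; rewrite ma; lra.
apply: Or32.
(* Otherwise [a] is raised only to [1/3] and [k] lowered to the [b'] that preserves the sum;
   [m > 1/3] gives [b' >= 1/3]. *)
pose b' := k - (3 * P * (3^-1 - a)) / (2 * Q).
have eb : 2 * Q * b' = 2 * Q * k - 3 * P * (3^-1 - a).
  by rewrite /b' mulrBr [2 * Q * (_ / _)]mulrC divfK//; lra.
have b3 : 3^-1 <= b'.
  by rewrite -(@ler_pM2l _ (2 * Q)) ?eb; nra.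
have bk : b' <= k.
  by rewrite -(@ler_pM2l _ (2 * Q)) ?eb; nra.
exists b'; split; [lra|lra|].
have sp : 3 * P * F 3^-1 + 2 * Q * F b' <= 3 * P * F a + 2 * Q * F k.
  by apply: spread2; lra.
by clear -eV sp; lra.
Qed.

End Reduction.

Lemma dominated_fdist {R : realType} (F : R -> R) (D : fdist R) :
  convex01 F -> (forall x, -1 <= x <= 1 -> F (- x) = - F x) ->
  (forall x, x \in D -> 0 <= x.1 /\ inP x.2) ->
  dominated F (\sum_(x <- D) x.1)
    (\sum_(x <- D) x.1 * (x.2.1.1 + x.2.1.2 + x.2.2))
    (\sum_(x <- D) x.1 * (F x.2.1.1 + F x.2.1.2 + F x.2.2)).
Proof.
move=> Fcvx Fodd; elim: D => [|[w [[x y] z]] D IH] h.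
  rewrite !big_nil; exists 0, 0, 0, 0, 0.
  split; [by split|by rewrite lexx invr_ge0 ler0n|by rewrite lexx ler01|].
  by split; rewrite !(mulr0, mul0r, oppr0, addr0).
rewrite !big_cons /=; apply: (dominatedD _ Fcvx); last first.
  by apply: IH => u uD; apply: h; rewrite inE uD orbT.
have [w0 xP] := h (w, (x, y, z)) (mem_head _ _).
by rewrite -[X in dominated _ X]mulr1; apply: dominatedZ => //;
  exact: (dominated_point _ Fcvx Fodd).
Qed.

(** * Expectation of bounded measurable functions *)

Section BoundedMeasurable.
Context {R : realType}.

(** Bounded measurable functions are closed under the operations below and integrable for every
    probability measure, so the integral rules need no further integrability conditions. *)
Definition bmf {d : measure_display} {T : measurableType d} (f : T -> R) :=
  measurable_fun [set: T] f /\ exists M, forall x, `|f x| <= M.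

Lemma bmf_le1 {d} {T : measurableType d} (f : T -> R) :
  measurable_fun [set: T] f -> (forall x, -1 <= f x <= 1) -> bmf f.
Proof. by move=> mf f1; split=> //; exists 1 => x; rewrite ler_norml. Qed.

Lemma bmf_cst {d} {T : measurableType d} (c : R) : bmf (fun _ : T => c).
Proof. by split=> //; exists `|c|. Qed.

Lemma bmf_comp {d d'} {T : measurableType d} {T' : measurableType d'}
    (h : T' -> T) (f : T -> R) :
  measurable_fun [set: T'] h -> bmf f -> bmf (fun x => f (h x)).
Proof.
move=> mh [mf [M fM]]; split; last by exists M => x.
exact: measurableT_comp.
Qed.

(** * Linearity, monotonicity and Cauchy-Schwarz for expectations *)

Section Expectation.
Context {d : measure_display} {T : measurableType d}.
Implicit Types f g : T -> R.

Lemma bmfD f g : bmf f -> bmf g -> bmf (fun x => f x + g x).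
Proof.
move=> [mf [M fM]] [mg [N gN]]; split; first exact: measurable_funD.
by exists (M + N) => x; rewrite (le_trans (ler_normD _ _))// lerD.
Qed.

Lemma bmfN f : bmf f -> bmf (fun x => - f x).
Proof.
move=> [mf [M fM]]; split; first exact: measurableT_comp.
by exists M => x; rewrite normrN.
Qed.

Lemma bmfM f g : bmf f -> bmf g -> bmf (fun x => f x * g x).
Proof.
move=> [mf [M fM]] [mg [N gN]]; split; first exact: measurable_funM.
by exists (M * N) => x; rewrite normrM ler_pM.
Qed.

(* Nonnegativity is only needed for Tonelli and for the changes of variables:
   a bounded function becomes nonnegative after adding a constant. *)
Lemma bmf_ge0 (f : T -> R) : bmf f ->
  exists M, bmf (fun x => f x + M) /\ forall x, 0 <= f x + M.
Proof.
move=> bf; case: (bf) => _ [M fM]; exists M; split.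
  by apply: bmfD => //; exact: bmf_cst.
by move=> x; have := fM x; rewrite ler_norml => /andP[]; lra.
Qed.

Context (P : probability T R).

Let PT : P [set: T] = 1%E. Proof. exact: probability_setT. Qed.

Lemma bmf_integrable f : bmf f -> P.-integrable [set: T] (EFin \o f).
Proof.
move=> [mf [M fM]]; apply/integrableP; split; first exact/measurable_EFinP.
apply: (@le_lt_trans _ _ (\int[P]_x (M%:E))%E).
  apply: ge0_le_integral => //=.
    by apply/measurable_EFinP; exact: measurableT_comp.
  by move=> x _; rewrite lee_fin.
by rewrite integral_cst//= [X in (_ * X)%E](_ : _ = 1%E) ?mule1 ?ltry.
Qed.

Lemma Exp_cst (c : R) : \int[P]_x c = c.
Proof.
by rewrite Rintegral_cst// (_ : fine _ = 1) ?mulr1//; exact: (congr1 fine PT).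
Qed.

Lemma ExpD f g : bmf f -> bmf g ->
  \int[P]_x (f x + g x) = \int[P]_x f x + \int[P]_x g x.
Proof. by move=> bf bg; rewrite RintegralD//; exact: bmf_integrable. Qed.

Lemma ExpB f g : bmf f -> bmf g ->
  \int[P]_x (f x - g x) = \int[P]_x f x - \int[P]_x g x.
Proof. by move=> bf bg; rewrite RintegralB//; exact: bmf_integrable. Qed.

Lemma ExpZ (c : R) f : bmf f -> \int[P]_x (c * f x) = c * \int[P]_x f x.
Proof. by move=> bf; rewrite RintegralZl//; exact: bmf_integrable. Qed.

Lemma ExpN f : bmf f -> \int[P]_x (- f x) = - \int[P]_x f x.
Proof.
move=> bf; rewrite -mulN1r -ExpZ//; apply: eq_Rintegral => x _.
by rewrite mulN1r.
Qed.

Lemma le_Exp f g : bmf f -> bmf g -> (forall x, f x <= g x) ->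
  \int[P]_x f x <= \int[P]_x g x.
Proof.
by move=> bf bg fg; apply: le_Rintegral => //; exact: bmf_integrable.
Qed.

Lemma Exp_bound f (M : R) : bmf f -> (forall x, `|f x| <= M) ->
  `|\int[P]_x f x| <= M.
Proof.
move=> bf fM; rewrite ler_norml; apply/andP; split.
  rewrite -[leLHS]Exp_cst; apply: le_Exp => //; first exact: bmf_cst.
  by move=> x; have := fM x; rewrite ler_norml => /andP[].
rewrite -[leRHS]Exp_cst; apply: le_Exp => //; first exact: bmf_cst.
by move=> x; have := fM x; rewrite ler_norml => /andP[].
Qed.

Lemma Exp_Cauchy_Schwarz f g : bmf f -> bmf g ->
  (\int[P]_x (f x * g x)) ^+ 2 <=
  (\int[P]_x (f x * f x)) * (\int[P]_x (g x * g x)).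
Proof.
move=> bf bg.
set A := \int[P]_x (f x * f x); set B := \int[P]_x (f x * g x).
set C := \int[P]_x (g x * g x).
(* The expectation of [(f + t g)^2]; the claim is the discriminant condition. *)
have H t : 0 <= A + 2 * t * B + t ^+ 2 * C.
  have -> : A + 2 * t * B + t ^+ 2 * C =
      \int[P]_x ((f x + t * g x) * (f x + t * g x)).
    rewrite -ExpZ; last exact: bmfM.
    rewrite -ExpZ; last exact: bmfM.
    rewrite -ExpD; [|exact: bmfM|apply: bmfM; [exact: bmf_cst|exact: bmfM]].
    rewrite -ExpD.
    - by apply: eq_Rintegral => x _; ring.
    - apply: bmfD; first exact: bmfM.
      by apply: bmfM; [exact: bmf_cst|exact: bmfM].
    - by apply: bmfM; [exact: bmf_cst|exact: bmfM].
  by apply: Rintegral_ge0 => x _; rewrite -expr2 sqr_ge0.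
have C0 : 0 <= C by apply: Rintegral_ge0 => x _; rewrite -expr2 sqr_ge0.
have [C0'|Cn0] := eqVneq C 0.
  have [->|Bn0] := eqVneq B 0; first by rewrite C0' expr0n mulr0.
  (* With [C = 0] the polynomial is affine in [t] and takes the value [-1] here. *)
  exfalso; have := H (- (A + 1) / (2 * B)).
  have -> : A + 2 * (- (A + 1) / (2 * B)) * B + (- (A + 1) / (2 * B)) ^+ 2 * C
     = -1 by rewrite C0'; field.
  by rewrite ler0N1.
have Cp : 0 < C by rewrite lt_neqAle eq_sym Cn0.
have := H (- B / C).
have -> : A + 2 * (- B / C) * B + (- B / C) ^+ 2 * C = (A * C - B ^+ 2) / C.
  by field.
by rewrite pmulr_lge0 ?invr_gt0// subr_ge0.
Qed.

End Expectation.

(** * Iterated expectations *)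

Section Fubini.
Context {d1 d2 : measure_display} {T1 : measurableType d1}
  {T2 : measurableType d2}.
Context (P1 : probability T1 R) (P2 : probability T2 R).
Implicit Types f : T1 * T2 -> R.

Lemma bmf_sect1 f x : bmf f -> bmf (fun y => f (x, y)).
Proof. by apply: bmf_comp. Qed.

Lemma bmf_sect2 f y : bmf f -> bmf (fun x => f (x, y)).
Proof. by apply: bmf_comp. Qed.

(** Measurability comes from Tonelli's theorem, applied to the nonnegative translate [f + M]. *)
Lemma bmf_Exp f : bmf f -> bmf (fun x => \int[P2]_y f (x, y)).
Proof.
move=> bf; split; last first.
  case: (bf) => _ [M fM]; exists M => x.
  by apply: Exp_bound => //; exact: bmf_sect1.
have [M [bg g0]] := bmf_ge0 f bf.
rewrite (_ : (fun x => _) =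
    fun x => fine (\int[P2]_y (f (x, y) + M)%:E)%E - M).
  apply: measurable_funB => //.
  apply: (measurableT_comp (@fine_measurable R _ measurableT)) => //.
  apply: (measurable_fun_fubini_tonelli_F (fun z => (f z + M)%:E)) => //.
  by apply/measurable_EFinP; case: bg.
apply/funext => x; rewrite -[X in _ - X](Exp_cst P2).
rewrite -[fine _]/(\int[P2]_y (f (x, y) + M)) -ExpB; last 2 first.
- exact: (bmf_sect1 (fun z => f z + M)).
- exact: bmf_cst.
by apply: eq_Rintegral => y _; rewrite addrK.
Qed.

Lemma Exp_Fubini f : bmf f ->
  \int[P1]_x \int[P2]_y f (x, y) = \int[P2]_y \int[P1]_x f (x, y).
Proof.
move=> bf; rewrite /Rintegral; congr fine.
have If := bmf_integrable (P1 \x P2)%E f bf.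
transitivity (\int[P1]_x \int[P2]_y (f (x, y))%:E)%E.
  apply: eq_integral => x _; rewrite fineK//.
  apply: integrable_fin_num => //.
  by apply: (bmf_integrable P2 (fun y => f (x, y))); exact: bmf_sect1.
rewrite (Fubini If); apply: eq_integral => y _; rewrite fineK//.
apply: integrable_fin_num => //.
by apply: (bmf_integrable P1 (fun x => f (x, y))); exact: bmf_sect2.
Qed.

End Fubini.
End BoundedMeasurable.

(** * The standard normal distribution on the line *)

Section StandardNormal.
Context {R : realType}.
Notation mu := (@lebesgue_measure R).
Notation std := (normal_prob (0 : R) 1).
Notation pdf := (normal_pdf (0 : R) 1).

Let n1 : (1 : R) != 0. Proof. exact: oner_neq0. Qed.

Lemma pdfE (x : R) : pdf x = normal_peak 1 * expR (- x ^+ 2 / 2).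
Proof. by rewrite normal_pdfE// /normal_fun subr0 expr1n. Qed.

Lemma pdfN (x : R) : pdf (- x) = pdf x.
Proof. by rewrite !pdfE sqrrN. Qed.

Lemma measurable_pdf : measurable_fun [set: R] pdf.
Proof. exact: measurable_normal_pdf. Qed.

(** The Radon-Nikodym derivative of the normal law agrees almost everywhere with its explicit
    density. *)
Lemma Exp_std (f : R -> R) : bmf f ->
  (\int[std]_x f x)%:E = (\int[mu]_x (f x * pdf x)%:E)%E.
Proof.
move=> bf; have intf := bmf_integrable std f bf.
rewrite /Rintegral fineK; last exact: integrable_fin_num.
have dom := normal_prob_dominates 0 (1 : R).
rewrite -(Radon_Nikodym_change_of_variables dom)//=.
have mf : measurable_fun [set: R] (fun x => (f x)%:E).
  by apply/measurable_EFinP; case: bf.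
apply: ae_eq_integral => //.
- apply: emeasurable_funM => //.
- by apply/measurable_EFinP; apply: measurable_funM;
    [case: bf|exact: measurable_pdf].
- rewrite (_ : (fun x => (f x * pdf x)%:E) =
    (fun x => (f x)%:E * (pdf x)%:E)%E); last by apply/funext => x; rewrite EFinM.
  apply: ae_eqe_mul2l => /=.
  rewrite Radon_NikodymE/=.
  case: cid => /= h [h1 h2 h3].
  apply: integral_ae_eq => //=.
  + by apply/measurable_EFinP; exact: measurable_pdf.
  + by move=> E E01 mE; rewrite -h3.
Qed.

(** By uniqueness of Lebesgue measure: [a] times the image of [mu] under [x |-> a x + b] agrees with
    [mu] on half-open intervals. *)
Lemma ge0_lebesgue_affine (h : R -> \bar R) (a b : R) : 0 < a ->
  measurable_fun [set: R] h -> (forall x, 0 <= h x)%E ->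
  (\int[mu]_x h x = \int[mu]_x (a%:E * h (a * x + b)%R))%E.
Proof.
move=> a0 mh h0.
have ma : measurable_fun [set: R] (fun x : R => a * x + b).
  by apply: measurable_funD => //; exact: measurable_funM.
pose psi : measurableTypeR R -> measurableTypeR R := fun x : R => a * x + b.
have mpsi : measurable_fun [set: measurableTypeR R] psi by exact: ma.
pose nu0 := mscale (NngNum (ltW a0)) (pushforward mu psi).
pose nu := nu0 mpsi.
have e A : measurable A -> mu A = nu A.
  move=> mA; apply: (@lebesgue_measure_unique R nu) => //.
  move=> _ [[u v] _ <-].
  transitivity (a%:E * mu (psi @^-1` `]u, v]))%E; last by [].
  have -> : psi @^-1` `]u, v]%classic = `](u - b) / a, (v - b) / a]%classic.
    apply/seteqP; split => x /=; rewrite !in_itv/= /psi;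
      rewrite ltr_pdivrMr// ler_pdivlMr// ltrBlDr lerBrDr mulrC//.
  rewrite !lebesgue_measure_itv/= !lte_fin ltr_pM2r ?invr_gt0// ltrD2r.
  case: ifPn => _; last by rewrite mule0.
  by rewrite -EFinD -!EFinB -EFinM; congr EFin; field; rewrite gt_eqF.
rewrite ge0_integralZl//=; last 2 first.
  by apply: measurableT_comp.
  by rewrite lee_fin ltW.
transitivity (\int[nu]_x h x)%E.
  by apply: eq_measure_integral => A mA _; exact: e.
rewrite ge0_integral_mscale//=; congr (_ * _)%E.
by rewrite ge0_integral_pushforward.
Qed.

Lemma ge0_lebesgueN (h : R -> \bar R) :
  measurable_fun [set: R] h -> (forall x, 0 <= h x)%E ->
  (\int[mu]_x h x = \int[mu]_x (h (- x)%R))%E.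
Proof.
move=> mh h0.
transitivity (\int[pushforward mu (-%R : _ -> measurableTypeR R)]_x h x)%E.
  by apply: eq_measure_integral => A mA _; exact/esym/lebesgue_measureN.
by rewrite ge0_integral_pushforward.
Qed.

Lemma measurable_affine (a b : R) : measurable_fun [set: R] (fun x : R => a * x + b).
Proof. by apply: measurable_funD => //; exact: measurable_funM. Qed.

Lemma measurable_pdf_affine (a b : R) :
  measurable_fun [set: R] (fun x : R => pdf (a * x + b)).
Proof.
apply: (@measurableT_comp _ _ _ _ _ _ pdf); first exact: measurable_pdf.
exact: measurable_affine.
Qed.

Lemma bmf_affine (f : R -> R) (a b : R) : bmf f -> bmf (fun x => f (a * x + b)).
Proof. by apply: bmf_comp; exact: measurable_affine. Qed.

Lemma Exp_std_shift (f : R -> R) (m : R) : bmf f -> (forall x, 0 <= f x) ->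
  (\int[std]_x f (x + m))%:E = (\int[mu]_x (f x * pdf (x - m))%:E)%E.
Proof.
move=> bf f0.
rewrite (@ge0_lebesgue_affine (fun x => (f x * pdf (x - m))%:E) 1 m)//.
- rewrite Exp_std; last first.
    rewrite (_ : (fun x => _) = fun x => f (1 * x + m)); first exact: bmf_affine.
    by apply/funext => x; rewrite mul1r.
  by apply: eq_integral => x _; rewrite mul1e mul1r addrK.
- apply/measurable_EFinP; apply: measurable_funM; first by case: bf.
  rewrite (_ : (fun x => _) = fun x => pdf (1 * x + (- m))).
    exact: measurable_pdf_affine.
  by apply/funext => x; rewrite mul1r.
- by move=> x; rewrite lee_fin mulr_ge0// normal_pdf_ge0.
Qed.

Lemma Exp_stdN (f : R -> R) : bmf f -> \int[std]_x f (- x) = \int[std]_x f x.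
Proof.
have bN (g : R -> R) : bmf g -> bmf (fun x : R => g (- x)).
  by move=> bg; apply: bmf_comp => //; exact: measurable_oppr.
move=> bf; have [M [bg g0]] := bmf_ge0 f bf.
apply: (@addIr _ M); rewrite -[X in _ + X](Exp_cst std) -[in RHS](Exp_cst std M).
rewrite -!ExpD//; [|exact: bmf_cst|exact: bN|exact: bmf_cst].
apply: EFin_inj; rewrite (Exp_std _ bg) Exp_std; last exact: (bN (fun x => f x + M) bg).
rewrite [RHS]ge0_lebesgueN; first by apply: eq_integral => x _; rewrite pdfN.
  apply/measurable_EFinP; apply: measurable_funM; last exact: measurable_pdf.
  by case: bg.
by move=> x; rewrite lee_fin mulr_ge0// normal_pdf_ge0.
Qed.

Lemma Exp_std2 (f : R * R -> R) : bmf f -> (forall z, 0 <= f z) ->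
  (\int[std]_x \int[std]_y f (x, y))%:E =
  (\int[mu]_x \int[mu]_y (f (x, y) * (pdf x * pdf y))%:E)%E.
Proof.
move=> bf f0; rewrite Exp_std; last exact: (bmf_Exp std f bf).
apply: eq_integral => x _; rewrite EFinM Exp_std; last exact: (bmf_sect1 f x bf).
rewrite -ge0_integralZr//.
- by apply: eq_integral => y _; rewrite -EFinM mulrAC mulrA.
- apply/measurable_EFinP; apply: measurable_funM; last exact: measurable_pdf.
  by case: (bmf_sect1 f x bf).
- by move=> y _; rewrite lee_fin mulr_ge0// normal_pdf_ge0.
- by rewrite lee_fin normal_pdf_ge0.
Qed.

Lemma measurable_lin2 {d} {T : measurableType d} (u v : T -> R) (a b : R) :
  measurable_fun [set: T] u -> measurable_fun [set: T] v ->
  measurable_fun [set: T] (fun z => a * u z + b * v z).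
Proof. by move=> mu_ mv; apply: measurable_funD; exact: measurable_funM. Qed.

Lemma bmf_rot (f : R * R -> R) (c s : R) : bmf f ->
  bmf (fun z : R * R => f (c * z.1 + s * z.2, s * z.1 - c * z.2)).
Proof.
apply: (@bmf_comp _ _ _ _ _ (fun z : R * R => (c * z.1 + s * z.2, s * z.1 - c * z.2))).
apply/measurable_fun_pair; first exact: measurable_lin2.
under eq_fun do rewrite -mulNr.
exact: measurable_lin2.
Qed.

(** The joint density depends only on [u^2 + v^2], which the reflection preserves. *)
Lemma pdf_rot (c s u v : R) : c ^+ 2 + s ^+ 2 = 1 ->
  pdf (c * u + s * v) * pdf (s * u - c * v) = pdf u * pdf v.
Proof.
move=> cs; rewrite !pdfE [LHS]mulrACA [RHS]mulrACA -!expRD; congr (_ * expR _).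
have -> : u ^+ 2 = (c ^+ 2 + s ^+ 2) * u ^+ 2 by rewrite cs mul1r.
have -> : v ^+ 2 = (c ^+ 2 + s ^+ 2) * v ^+ 2 by rewrite cs mul1r.
by field.
Qed.

(* Substitute u = c x + s y for y with x fixed, exchange the integrals, then
   substitute v = (x - c u) / s for x with u fixed. *)
Lemma Exp_std_rot_gt0 (f : R * R -> R) (c s : R) : bmf f -> 0 < s ->
  c ^+ 2 + s ^+ 2 = 1 -> (forall z, 0 <= f z) ->
  \int[std]_x \int[std]_y f (c * x + s * y, s * x - c * y) =
  \int[std]_x \int[std]_y f (x, y).
Proof.
move=> bf s0 cs f0; apply: EFin_inj; have sn0 : s != 0 by rewrite gt_eqF.
rewrite (Exp_std2 (fun z => f (c * z.1 + s * z.2, s * z.1 - c * z.2)))//;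
  last exact: bmf_rot.
rewrite (Exp_std2 f bf f0).
pose k (z : R * R) := f (z.2, z.1 / s - c / s * z.2) *
   (pdf z.1 * pdf (s^-1 * z.2 - c / s * z.1)) / s.
have mk : measurable_fun [set: R * R] k.
  apply: measurable_funM => //; apply: measurable_funM.
    apply: (@measurableT_comp _ _ _ _ _ _ f); first by case: bf.
    apply/measurable_fun_pair => //=.
    rewrite (_ : (fun z => _) = fun z : R * R => s^-1 * z.1 + (- (c / s)) * z.2).
      exact: measurable_lin2.
    by apply/funext => z; ring.
  apply: measurable_funM.
    by apply: (@measurableT_comp _ _ _ _ _ _ pdf) => //; exact: measurable_pdf.
  apply: (@measurableT_comp _ _ _ _ _ _ pdf); first exact: measurable_pdf.
  rewrite (_ : (fun z => _) = fun z : R * R => s^-1 * z.2 + (- (c / s)) * z.1).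
    exact: measurable_lin2.
  by apply/funext => z; ring.
have k0 z : 0 <= k z.
  apply: divr_ge0; last exact: ltW.
  by do ?apply: mulr_ge0 => //; exact: normal_pdf_ge0.
transitivity (\int[mu]_x \int[mu]_u (k (x, u))%:E)%E.
  apply: eq_integral => x _.
  rewrite [LHS](@ge0_lebesgue_affine _ s^-1 (- (c / s) * x)) ?invr_gt0//; first last.
  - move=> y; rewrite lee_fin; apply: mulr_ge0; first exact: f0.
    by apply: mulr_ge0; exact: normal_pdf_ge0.
  - apply/measurable_EFinP; apply: measurable_funM.
      by case: (bmf_sect1 _ x (bmf_rot f c s bf)).
    by apply: measurable_funM => //; exact: measurable_pdf.
  apply: eq_integral => u _; rewrite -EFinM /k /=; congr EFin.
  rewrite mulrC; congr (f (_, _) * (_ * pdf _) / s).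
  - by field.
  - transitivity (((c ^+ 2 + s ^+ 2) * x - c * u) / s); first by field.
    by rewrite cs mul1r; field.
  - by ring.
transitivity (\int[mu]_u \int[mu]_x (k (x, u))%:E)%E.
  apply: (@fubini_tonelli _ _ _ _ R mu mu (fun z => (k z)%:E)).
    exact/measurable_EFinP.
  by move=> z; rewrite lee_fin.
apply: eq_integral => u _.
rewrite [LHS](@ge0_lebesgue_affine _ s (c * u))//; first last.
- by move=> y; rewrite lee_fin.
- apply/measurable_EFinP.
  by apply: (@measurableT_comp _ _ _ _ _ _ k) => //; exact: measurable_fun_pair.
apply: eq_integral => v _; rewrite -EFinM /k /=; congr EFin.
rewrite mulrC divfK//; congr (f (_, _) * _).
- by field.
- rewrite -(pdf_rot c s u v cs) addrC; congr (_ * _).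
  have -> : s * u - c * v = ((c ^+ 2 + s ^+ 2) * u - c ^+ 2 * u) / s - c * v.
    by field.
  by rewrite cs mul1r; congr pdf; field.
Qed.

Lemma Exp_std_rot (f : R * R -> R) (c s : R) : bmf f -> 0 <= c -> 0 <= s ->
  c ^+ 2 + s ^+ 2 = 1 ->
  \int[std]_x \int[std]_y f (c * x + s * y, s * x - c * y) =
  \int[std]_x \int[std]_y f (x, y).
Proof.
(* For [s = 0] the map is [(x, y) |-> (x, -y)], covered by the evenness of the density. *)
move=> bf c0; rewrite le_eqVlt => /predU1P[<-|s0] cs.
  have c1 : c = 1.
    by apply/eqP; rewrite -(@eqrXn2 _ 2)// expr1n; apply/eqP; rewrite -cs expr0n/= addr0.
  apply: eq_Rintegral => x _; rewrite c1.
  rewrite -[RHS](Exp_stdN (fun y => f (x, y))); last exact: (bmf_sect1 f x bf).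
  by apply: eq_Rintegral => y _; rewrite !mul1r !mul0r addr0 add0r.
have [M [bg g0]] := bmf_ge0 f bf.
have E (h : R * R -> R) : bmf h -> \int[std]_x \int[std]_y (h (x, y) + M) =
    \int[std]_x \int[std]_y h (x, y) + M.
  move=> bh; rewrite -[X in _ = _ + X](Exp_cst std) -ExpD; last exact: bmf_cst.
    apply: eq_Rintegral => x _; rewrite -[X in _ = _ + X](Exp_cst std) -ExpD//.
      exact: bmf_sect1.
    exact: bmf_cst.
  exact: (bmf_Exp std h bh).
apply: (@addIr _ M); rewrite -E// -(E (fun z => f (c * z.1 + s * z.2, s * z.1 - c * z.2))).
  exact: (Exp_std_rot_gt0 _ _ _ bg).
exact: bmf_rot.
Qed.

End StandardNormal.

(** * Comparison of shifted Gaussians on the line *)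

Section TotalVariation.
Context {R : realType}.
Notation mu := (@lebesgue_measure R).
Notation std := (normal_prob (0 : R) 1).
Notation pdf := (normal_pdf (0 : R) 1).
Notation peak := (normal_peak (1 : R)).

Lemma pdf_shift (x m : R) : pdf (x - m) = expR (m * x - m ^+ 2 / 2) * pdf x.
Proof.
rewrite !pdfE mulrCA -expRD; congr (_ * expR _); by field.
Qed.

Lemma pdf_le (x y : R) : y ^+ 2 <= x ^+ 2 -> pdf x <= pdf y.
Proof.
move=> xy; rewrite !pdfE ler_wpM2l ?normal_peak_ge0// ler_expR.
by rewrite ler_wpM2r// ?invr_ge0// lerN2.
Qed.

Lemma bmf_min1 (t : R) : 0 <= t -> bmf (fun x : R => Num.min 1 (t * `|x|)).
Proof.
move=> t0; split.
  apply: measurable_minr => //; apply: measurable_funM => //.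
exists 1 => x; rewrite ger0_norm ?ge_min ?lexx//.
by rewrite le_min ler01/= mulr_ge0.
Qed.

Let measurable_pdf_shift (m : R) : measurable_fun [set: R] (fun x : R => pdf (x - m)).
Proof.
rewrite (_ : (fun x => _) = fun x => pdf (1 * x + (- m))).
  exact: measurable_pdf_affine.
by apply/funext => x; rewrite mul1r.
Qed.

(** Since [|x| <= e^x + e^(-x)] and multiplying the density by [e^x] or [e^(-x)] gives [e^(1/2)]
    times a density shifted by 1, the integral is at most [2 e^(1/2) t]. Truncation at 1 keeps the
    integrand bounded. *)
Lemma Exp_std_abs (t : R) : 0 <= t ->
  \int[std]_x Num.min 1 (t * `|x|) <= 2 * expR 2^-1 * t.
Proof.
move=> t0; rewrite -lee_fin (Exp_std _ (bmf_min1 t t0)).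
pose C := t * expR 2^-1.
have C0 : 0 <= C by rewrite mulr_ge0// expR_ge0.
have one m : (\int[mu]_x (pdf (x - m))%:E = 1)%E.
  have := Exp_std_shift (fun _ => 1) m (bmf_cst 1) (fun _ => ler01).
  rewrite Exp_cst => ->; apply: eq_integral => x _; by rewrite mul1r.
have mp m : measurable_fun [set: R] (fun x => (pdf (x - m))%:E).
  exact/measurable_EFinP.
have p0 x : (0 <= (pdf x)%:E)%E by rewrite lee_fin normal_pdf_ge0.
apply: (@le_trans _ _
    (\int[mu]_x (C%:E * ((pdf (x - 1))%:E + (pdf (x - (- 1)))%:E)))%E).
  apply: ge0_le_integral => //=.
  - by move=> x _; rewrite lee_fin mulr_ge0 ?normal_pdf_ge0// le_min ler01 mulr_ge0.
  - apply/measurable_EFinP; apply: measurable_funM; last exact: measurable_pdf.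
    by case: (bmf_min1 t t0).
  - by apply: emeasurable_funM => //; apply: emeasurable_funD; exact: mp.
  - move=> x _; rewrite lee_fin !pdf_shift -mulrDl /C.
    have e1 : expR (1 * x - 1 ^+ 2 / 2) = expR x * (expR (2^-1 : R))^-1.
      by rewrite mul1r expr1n mul1r expRB.
    have e2 : expR (-1 * x - (-1) ^+ 2 / 2) = expR (- x) * (expR (2^-1 : R))^-1.
      by rewrite mulN1r sqrrN expr1n mul1r expRB.
    rewrite e1 e2 -mulrDl mulrA.
    apply: ler_wpM2r; first exact: normal_pdf_ge0.
    rewrite -mulrA [expR 2^-1 * _]mulrC divfK ?gt_eqF ?expR_gt0//.
    apply: (@le_trans _ _ (t * `|x|)); first by rewrite ge_min lexx orbT.
    rewrite ler_wpM2l//.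
    have := expR_ge1Dx x; have := expR_ge1Dx (- x).
    have := expR_ge0 x; have := expR_ge0 (- x).
    by case: (ger0P x) => ?; lra.
rewrite ge0_integralZl//.
- rewrite ge0_integralD//; [|exact: mp|exact: mp].
  rewrite [X in (X + _)%E](one 1) [X in (_ + X)%E](one (-1)).
  by rewrite -EFinD -EFinM lee_fin /C; lra.
- by apply: emeasurable_funD; exact: mp.
- by move=> x _; rewrite adde_ge0.
Qed.

Let I : R -> R := \1_(`[0, +oo[%classic).

Let IE x : I x = (0 <= x)%R%:R.
Proof. by rewrite /I indicE mem_setE in_itv/= andbT. Qed.

Let bI : bmf I.
Proof.
split; first exact: measurable_indic.
by exists 1 => x; rewrite IE; case: (0 <= x); rewrite ?normr0 ?normr1.
Qed.

Let I_ge0 x : 0 <= I x. Proof. by rewrite IE. Qed.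

(* Pairing k against the density difference pdf (x - m) - pdf (x + m) is maximal
   for the indicator I of the half-line on which this difference is nonnegative. *)
Let le_halfline (k : R -> R) (m : R) : bmf k -> (forall x, 0 <= k x <= 1) -> 0 <= m ->
  \int[std]_x k (x + m) + \int[std]_x I (x - m) <=
  \int[std]_x k (x - m) + \int[std]_x I (x + m).
Proof.
move=> bk k01 m0; rewrite -lee_fin !EFinD.
have k0 x : 0 <= k x by have /andP[] := k01 x.
have mM (h : R -> R) m' : bmf h ->
    measurable_fun [set: R] (fun x => (h x * pdf (x - m'))%:E).
  by move=> [mh _]; apply/measurable_EFinP; exact: measurable_funM.
rewrite (Exp_std_shift _ m bk k0) (Exp_std_shift _ (- m) bI I_ge0).
rewrite (Exp_std_shift _ (- m) bk k0) (Exp_std_shift _ m bI I_ge0).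
have p0 (h : R -> R) m' : (forall x, 0 <= h x) ->
    forall x, (0 <= (h x * pdf (x - m'))%:E)%E.
  by move=> h0 x; rewrite lee_fin mulr_ge0// normal_pdf_ge0.
have D (h h' : R -> R) u v : bmf h -> bmf h' -> (forall x, 0 <= h x) ->
    (forall x, 0 <= h' x) ->
    (\int[mu]_x (h x * pdf (x - u))%:E + \int[mu]_x (h' x * pdf (x - v))%:E =
     \int[mu]_x ((h x * pdf (x - u))%:E + (h' x * pdf (x - v))%:E))%E.
  move=> bh bh' h0 h0'; rewrite -ge0_integralD; first by [].
  - by [].
  - by move=> x _; exact: p0.
  - exact: mM.
  - by move=> x _; exact: p0.
  - exact: mM.
rewrite (D k I m (- m) bk bI k0 I_ge0) (D k I (- m) m bk bI k0 I_ge0).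
apply: ge0_le_integral => //=.
- by move=> x _; rewrite adde_ge0//; exact: p0.
- by apply: emeasurable_funD; exact: mM.
- by apply: emeasurable_funD; exact: mM.
move=> x _; rewrite -!EFinD lee_fin IE opprK; have /andP[kx0 kx1] := k01 x.
have [x0|x0] := lerP 0 x.
  have : pdf (x + m) <= pdf (x - m) by apply: pdf_le; rewrite !expr2; nra.
  move=> h; have : 0 <= (1 - k x) * (pdf (x - m) - pdf (x + m)).
    by rewrite mulr_ge0 ?subr_ge0.
  by rewrite /= mulr1n; lra.
have : pdf (x - m) <= pdf (x + m) by apply: pdf_le; rewrite !expr2; nra.
move=> h; have : 0 <= k x * (pdf (x + m) - pdf (x - m)).
  by apply: mulr_ge0; [exact: kx0|rewrite subr_ge0; exact: h].
by rewrite /= mulr0n; lra.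
Qed.

(** The two indicators differ only on [[-m, m]], of length [2m], where the density is at most
    [peak]. *)
Let halfline_diff (m : R) : 0 <= m ->
  \int[std]_x I (x + m) <= \int[std]_x I (x - m) + 2 * peak * m.
Proof.
move=> m0.
pose J : R -> R := \1_(`[- m, m]%classic).
have bJ : bmf J.
  split; first exact: measurable_indic.
  by exists 1 => x; rewrite /J indicE; case: (_ \in _); rewrite ?normr0 ?normr1.
have bs (u : R) : bmf (fun x : R => I (x + u)).
  rewrite (_ : (fun x => _) = fun x => I (1 * x + u)); first exact: bmf_affine.
  by apply/funext => x; rewrite mul1r.
apply: (@le_trans _ _ (\int[std]_x (I (x - m) + J x))).
  apply: le_Exp; [exact: bs|by apply: bmfD => //; exact: (bs (- m))|].
  move=> x; rewrite !IE /J indicE mem_setE in_itv/=.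
  case: (lerP 0 (x + m)) => h1; case: (lerP 0 (x - m)) => h2;
    case: (lerP (- m) x) => h3; case: (lerP x m) => h4 //=; rewrite ?addr0 ?add0r //; lra.
rewrite ExpD; [|exact: (bs (- m))|exact: bJ].
rewrite lerD2l -lee_fin (Exp_std _ bJ).
apply: (@le_trans _ _ (\int[mu]_x (peak%:E * (J x)%:E))%E).
  apply: ge0_le_integral => //=.
  - by move=> x _; rewrite lee_fin mulr_ge0 ?normal_pdf_ge0.
  - by apply/measurable_EFinP; apply: measurable_funM;
      [case: bJ|exact: measurable_pdf].
  - by apply/measurable_EFinP; apply: measurable_funM => //; case: bJ.
  - move=> x _; rewrite -EFinM lee_fin mulrC ler_wpM2r//.
    by apply: normal_pdf_ub; exact: oner_neq0.
rewrite ge0_integralZl//; last 3 first.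
- by apply/measurable_EFinP; case: bJ.
- by move=> x _; rewrite lee_fin.
- by rewrite lee_fin normal_peak_ge0.
have -> : (\int[mu]_x (J x)%:E = mu `[(- m)%R, m]%classic)%E.
  by rewrite integral_indic// setIT.
rewrite lebesgue_measure_itv/= lte_fin.
case: ifPn => _; last by rewrite mule0 lee_fin !mulr_ge0// normal_peak_ge0.
by rewrite -EFinD -EFinM lee_fin; lra.
Qed.

(** [k] is rescaled to [(k + 1) / 2], with values in [[0, 1]], and compared with the half-line;
    undoing the scaling doubles the constant to [4 * peak]. For negative [m] the bound is applied to
    [-k] and [-m]. *)
Lemma Exp_std_TV (k : R -> R) (m : R) : bmf k -> (forall x, `|k x| <= 1) ->
  \int[std]_x k (x + m) <= \int[std]_x k (x - m) + 4 * peak * `|m|.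
Proof.
have bs (u : R) (h : R -> R) : bmf h -> bmf (fun x : R => h (x + u)).
  move=> bh.
  rewrite (_ : (fun x => _) = fun x => h (1 * x + u)); first exact: bmf_affine.
  by apply/funext => x; rewrite mul1r.
have pos (h : R -> R) (u : R) : bmf h -> (forall x, `|h x| <= 1) -> 0 <= u ->
    \int[std]_x h (x + u) <= \int[std]_x h (x - u) + 4 * peak * u.
  move=> bh h1 u0.
  pose l x := 2^-1 * (h x + 1).
  have bh1 : bmf (fun x => h x + 1) by apply: bmfD => //; exact: bmf_cst.
  have bl : bmf l by apply: bmfM => //; exact: bmf_cst.
  have l01 x : 0 <= l x <= 1.
    by have := h1 x; rewrite ler_norml => /andP[? ?]; rewrite /l; lra.
  have El v : \int[std]_x l (x + v) = 2^-1 * (\int[std]_x h (x + v) + 1).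
    rewrite /l ExpZ ?ExpD ?Exp_cst//; [exact: bs|exact: bmf_cst|].
    exact: (bs v (fun x => h x + 1)).
  have := le_halfline l u bl l01 u0; rewrite !El.
  by have := halfline_diff u u0; lra.
move=> bk k1; have [m0|m0] := ger0P m; first exact: pos.
have bk' : bmf (fun x => - k x) by exact: bmfN.
have h1 : forall x, `|- k x| <= 1 by move=> x; rewrite normrN.
have := pos _ (- m) bk' h1; rewrite oppr_ge0 (ltW m0) => /(_ isT).
have -> : \int[std]_x (- k (x - m)) = - \int[std]_x k (x - m).
  exact: (ExpN std _ (bs (- m) k bk)).
rewrite opprK (_ : \int[std]_x (- k (x + m)) = - \int[std]_x k (x + m)); last first.
  exact: (ExpN std _ (bs m k bk)).
by lra.
Qed.

End TotalVariation.

(** * Gaussian vectors *)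

Section GaussianVectors.
Context {R : realType}.
Notation std := (normal_prob (0 : R) 1).

(** [corr_vec] is the case [b = sqrt (1 - a^2)]; free coefficients also cover rotations and sign
    changes. *)
Definition lin2 n (a b : R) (g z : n.-tuple R) : n.-tuple R :=
  [tuple a * tnth g i + b * tnth z i | i < n].

Lemma lin2_cons n a b x (g : n.-tuple R) y (z : n.-tuple R) :
  lin2 n.+1 a b [tuple of x :: g] [tuple of y :: z] =
  [tuple of (a * x + b * y) :: lin2 n a b g z].
Proof.
apply: eq_from_tnth => i; rewrite tnth_mktuple.
case: (unliftP ord0 i) => [j|] ->; last by rewrite !tnth0.
by rewrite !tnthS tnth_mktuple.
Qed.

Lemma measurable_lin2_tuple {d} {T : measurableType d} n (a b : R)
    (u v : T -> n.-tuple R) :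
  measurable_fun [set: T] u -> measurable_fun [set: T] v ->
  measurable_fun [set: T] (fun t => lin2 n a b (u t) (v t)).
Proof.
move=> mu_ mv; apply/measurable_fun_tnthP => i.
rewrite (_ : _ \o _ = fun t => a * tnth (u t) i + b * tnth (v t) i); last first.
  by apply/funext => t /=; rewrite tnth_mktuple.
by apply: measurable_lin2; apply: (measurableT_comp (measurable_tnth i)).
Qed.

Lemma bmf_cons n (f : n.+1.-tuple R -> R) : bmf f ->
  bmf (fun p : R * n.-tuple R => f [tuple of p.1 :: p.2]).
Proof. by apply: bmf_comp; exact: measurable_cons. Qed.

Lemma bmf_cons1 n (f : n.+1.-tuple R -> R) x : bmf f ->
  bmf (fun t : n.-tuple R => f [tuple of x :: t]).
Proof. by move=> /bmf_cons/(bmf_sect1 _ x). Qed.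

(** The image of [std \x P] under consing realizes one step of the recursion of [gauss_exp], which
    makes measure-theoretic integration available for it. *)
Lemma gauss_prob_ex n : exists P : probability (n.-tuple R) R,
  forall f : n.-tuple R -> R, bmf f -> gauss_exp f = \int[P]_x f x.
Proof.
elim: n => [|n [P HP]].
  exists (dirac [tuple]) => f bf /=.
  rewrite /Rintegral integral_dirac//=; first by rewrite indicT mul1r.
  by apply/measurable_EFinP; case: bf.
pose T := (measurableTypeR R * n.-tuple R)%type.
pose c (p : T) : n.+1.-tuple R := [tuple of p.1 :: p.2].
have mc : measurable_fun [set: T] c.
  exact: (@measurable_cons _ _ (R * n.-tuple R)%type R fst n snd).
pose X : {mfun T >-> n.+1.-tuple R} :=
  HB.pack c (isMeasurableFun.Build _ _ _ _ _ mc).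
exists (distribution (std \x P)%E X) => f bf /=.
have bfc : bmf (fun p : T => f (c p)) by exact: bmf_comp bf.
transitivity (\int[(std \x P)%E]_p f (c p)); last first.
  rewrite /Rintegral; congr fine.
  rewrite [RHS]integral_pushforward//=.
  - by apply/measurable_EFinP; case: bf.
  - exact: (bmf_integrable (std \x P)%E _ bfc).
rewrite /Rintegral.
rewrite -(integral12_prod_meas1 (bmf_integrable (std \x P)%E _ bfc)).
congr fine; apply: eq_integral => x _.
rewrite HP; last exact: bmf_cons1.
rewrite /Rintegral fineK//; apply: integrable_fin_num => //.
exact: (bmf_integrable P _ (bmf_cons1 n f x bf)).
Qed.

Definition gauss_prob n : probability (n.-tuple R) R :=
  projT1 (cid (gauss_prob_ex n)).

Lemma gauss_expE n (f : n.-tuple R -> R) : bmf f ->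
  gauss_exp f = \int[gauss_prob n]_x f x.
Proof. exact: (projT2 (cid (gauss_prob_ex n))). Qed.

Lemma gauss_probS n (f : n.+1.-tuple R -> R) : bmf f ->
  \int[gauss_prob n.+1]_x f x =
  \int[std]_x \int[gauss_prob n]_t f [tuple of x :: t].
Proof.
move=> bf; rewrite -gauss_expE//=; apply: eq_Rintegral => x _.
by rewrite gauss_expE//; exact: bmf_cons1.
Qed.

Lemma gauss_prob0 (f : 0.-tuple R -> R) : bmf f ->
  \int[gauss_prob 0]_x f x = f [tuple].
Proof. by move=> bf; rewrite -gauss_expE. Qed.

Lemma gauss_prob_opp n (f : n.-tuple R -> R) : bmf f ->
  \int[gauss_prob n]_x f (map_tuple (fun y => - y) x) = \int[gauss_prob n]_x f x.
Proof.
have mN m : measurable_fun [set: m.-tuple R] (map_tuple (fun y : R => - y)).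
  apply/measurable_fun_tnthP => i.
  rewrite (_ : _ \o _ = fun t : m.-tuple R => - tnth t i); last first.
    by apply/funext => t /=; rewrite tnth_map.
  by apply: measurable_funN; exact: measurable_tnth.
elim: n f => [|n IH] f bf.
  rewrite !gauss_prob0//; first by congr f; apply: tuple0.
  by apply: bmf_comp bf; exact: mN.
have bfN : bmf (fun x : n.+1.-tuple R => f (map_tuple (fun y => - y) x)).
  by apply: bmf_comp bf; exact: mN.
rewrite (gauss_probS n _ bfN) (gauss_probS n _ bf).
rewrite -[RHS]Exp_stdN; last exact: (bmf_Exp (gauss_prob n) _ (bmf_cons n f bf)).
apply: eq_Rintegral => x _.
rewrite -[RHS](IH (fun t => f [tuple of - x :: t])); last exact: bmf_cons1.
apply: eq_Rintegral => t _; congr f.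
exact: val_inj.
Qed.

(** The planar reflection acts on each pair of corresponding coordinates separately, so induction on
    [n] reduces to [Exp_std_rot]. *)
Lemma gauss_prob_rot n (f : n.-tuple R * n.-tuple R -> R) (c s : R) : bmf f ->
  0 <= c -> 0 <= s -> c ^+ 2 + s ^+ 2 = 1 ->
  \int[gauss_prob n]_g \int[gauss_prob n]_z
     f (lin2 n c s g z, lin2 n s (- c) g z) =
  \int[gauss_prob n]_g \int[gauss_prob n]_z f (g, z).
Proof.
move=> + c0 s0 cs; elim: n f => [|n IH] f bf.
  apply: eq_Rintegral => x _; apply: eq_Rintegral => y _.
  by rewrite !(tuple0 (lin2 0 _ _ _ _)) (tuple0 x) (tuple0 y).
(* Fubini moves the first coordinates of both vectors to the outside. *)
have split4 (h : n.+1.-tuple R * n.+1.-tuple R -> R) : bmf h ->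
    \int[gauss_prob n.+1]_g \int[gauss_prob n.+1]_z h (g, z) =
    \int[std]_x \int[std]_y \int[gauss_prob n]_g \int[gauss_prob n]_z
      h ([tuple of x :: g], [tuple of y :: z]).
  move=> bh; rewrite gauss_probS; last exact: bmf_Exp.
  apply: eq_Rintegral => x _.
  under eq_Rintegral do rewrite (gauss_probS n _ (bmf_sect1 _ _ bh)).
  apply: (Exp_Fubini (gauss_prob n) std
    (fun p => \int[gauss_prob n]_z h ([tuple of x :: p.1], [tuple of p.2 :: z]))).
  apply: (bmf_Exp (gauss_prob n) (fun q : (n.-tuple R * R) * n.-tuple R =>
    h ([tuple of x :: q.1.1], [tuple of q.1.2 :: q.2]))).
  apply: (@bmf_comp _ _ _ _ _ (fun q : (n.-tuple R * R) * n.-tuple R =>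
    ([tuple of x :: q.1.1] : n.+1.-tuple R, [tuple of q.1.2 :: q.2] : n.+1.-tuple R))) bh.
  apply/measurable_fun_pair; apply: measurable_cons => //.
    exact: measurableT_comp.
  exact: measurableT_comp.
have bfr : bmf (fun p : n.+1.-tuple R * n.+1.-tuple R =>
    f (lin2 n.+1 c s p.1 p.2, lin2 n.+1 s (- c) p.1 p.2)).
  apply: (@bmf_comp _ _ _ _ _ (fun p : n.+1.-tuple R * n.+1.-tuple R =>
    (lin2 n.+1 c s p.1 p.2, lin2 n.+1 s (- c) p.1 p.2))) bf.
  by apply/measurable_fun_pair; exact: measurable_lin2_tuple.
rewrite (split4 f bf).
rewrite (split4 (fun p => f (lin2 n.+1 c s p.1 p.2, lin2 n.+1 s (- c) p.1 p.2)) bfr).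
pose k (p : R * R) := \int[gauss_prob n]_g \int[gauss_prob n]_z
   f ([tuple of p.1 :: g], [tuple of p.2 :: z]).
have bk : bmf k.
  apply: (bmf_Exp (gauss_prob n) (fun q : (R * R) * n.-tuple R =>
    \int[gauss_prob n]_z f ([tuple of q.1.1 :: q.2], [tuple of q.1.2 :: z]))).
  apply: (bmf_Exp (gauss_prob n) (fun q : ((R * R) * n.-tuple R) * n.-tuple R =>
    f ([tuple of q.1.1.1 :: q.1.2], [tuple of q.1.1.2 :: q.2]))).
  apply: (@bmf_comp _ _ _ _ _ (fun q : ((R * R) * n.-tuple R) * n.-tuple R =>
    ([tuple of q.1.1.1 :: q.1.2] : n.+1.-tuple R,
     [tuple of q.1.1.2 :: q.2] : n.+1.-tuple R))) bf.
  apply/measurable_fun_pair; apply: measurable_cons => //.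
  - by apply: measurableT_comp => //; exact: measurableT_comp.
  - exact: measurableT_comp.
  - by apply: measurableT_comp => //; exact: measurableT_comp.
rewrite -[RHS](Exp_std_rot k c s bk c0 s0 cs).
apply: eq_Rintegral => x _; apply: eq_Rintegral => y _.
rewrite /k /= -(IH (fun p => f ([tuple of c * x + s * y :: p.1],
   [tuple of s * x - c * y :: p.2]))).
  apply: eq_Rintegral => g _; apply: eq_Rintegral => z _.
  by rewrite !lin2_cons mulNr.
apply: (@bmf_comp _ _ _ _ _ (fun p : n.-tuple R * n.-tuple R =>
    ([tuple of c * x + s * y :: p.1] : n.+1.-tuple R,
     [tuple of s * x - c * y :: p.2] : n.+1.-tuple R))) bf.
by apply/measurable_fun_pair; apply: measurable_cons.
Qed.

End GaussianVectors.

(** * Noise stability of an odd function *)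

Section NoiseStability.
Context {R : realType}.
Notation std := (normal_prob (0 : R) 1).
Notation peak := (normal_peak (1 : R)).
Notation gam := (@gauss_prob R).

(** The coefficient [a] is changed to [-a] one coordinate at a time; coordinate [i] costs
    [Exp_std_TV] with shift [a g_i / s]. *)
Lemma gauss_prob_TV n (h : n.-tuple R -> R) (a s : R) (g : n.-tuple R) :
  bmf h -> (forall x, `|h x| <= 1) -> 0 < s ->
  \int[gam n]_z h (lin2 n a s g z) <=
  \int[gam n]_z h (lin2 n (- a) s g z) +
  4 * peak / s * \sum_(i < n) `|a * tnth g i|.
Proof.
move=> + + s0.
have bl m (k : m.-tuple R -> R) b u : bmf k -> bmf (fun z => k (lin2 m b s u z)).
  by move=> bk; apply: (fun mh => bmf_comp _ k mh bk); exact: measurable_lin2_tuple.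
elim: n h g => [|n IH] h g bh h1.
  rewrite !gauss_prob0; [|exact: bl|exact: bl].
  by rewrite big_ord0 mulr0 addr0 !(tuple0 (lin2 0 _ _ _ _)).
rewrite !gauss_probS; [|exact: bl|exact: bl].
rewrite (tuple_eta g); set x0 := thead g; set g' := [tuple of behead g].
rewrite big_ord_recl tnth0.
under eq_bigr do rewrite tnthS.
have bc x b : bmf (fun z => h [tuple of x :: lin2 n b s g' z]).
  exact: (bl _ _ _ _ (bmf_cons1 n h x bh)).
have bk0 : bmf (fun p : R * n.-tuple R => h [tuple of p.1 :: lin2 n a s g' p.2]).
  apply: (fun mh => bmf_comp _ h mh bh); apply: measurable_cons => //.
  exact: measurable_lin2_tuple.
pose k u := \int[gam n]_t h [tuple of u :: lin2 n a s g' t].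
have bk : bmf k by exact: (bmf_Exp (gam n) _ bk0).
have k1 x : `|k x| <= 1 by apply: Exp_bound.
pose l x := k (s * x + 0).
have bl' : bmf l by exact: bmf_affine.
have tv := Exp_std_TV l (a * x0 / s) bl' (fun x => k1 _).
have sn0 : s != 0 by rewrite gt_eqF.
have e1 : \int[std]_x l (x + a * x0 / s) =
    \int[std]_x \int[gam n]_t h (lin2 n.+1 a s [tuple of x0 :: g'] [tuple of x :: t]).
  apply: eq_Rintegral => x _; rewrite /l /k; apply: eq_Rintegral => t _.
  by rewrite lin2_cons; congr (h [tuple of _ :: _]); field.
(* With the first coordinate already switched and frozen, the induction hypothesis switches the
   others. *)
have e2 : \int[std]_x l (x - a * x0 / s) <= \int[std]_x
    \int[gam n]_t h (lin2 n.+1 (- a) s [tuple of x0 :: g'] [tuple of x :: t]) +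
    4 * peak / s * \sum_(i < n) `|a * tnth g' i|.
  rewrite -[X in _ + X](Exp_cst std) -ExpD; last exact: bmf_cst; last first.
    apply: (bmf_Exp (gam n) (fun p : R * n.-tuple R =>
      h (lin2 n.+1 (- a) s [tuple of x0 :: g'] [tuple of p.1 :: p.2]))).
    exact: (bmf_cons n _ (bl _ _ (- a) [tuple of x0 :: g'] bh)).
  apply: le_Exp.
  - rewrite (_ : (fun x => _) = fun x => l (1 * x + (- (a * x0 / s)))).
      exact: bmf_affine.
    by apply/funext => x; rewrite mul1r.
  - apply: bmfD; last exact: bmf_cst.
    apply: (bmf_Exp (gam n) (fun p : R * n.-tuple R =>
      h (lin2 n.+1 (- a) s [tuple of x0 :: g'] [tuple of p.1 :: p.2]))).
    exact: (bmf_cons n _ (bl _ _ (- a) [tuple of x0 :: g'] bh)).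
  - move=> x; rewrite /l /k.
    have -> : \int[gam n]_t h (lin2 n.+1 (- a) s [tuple of x0 :: g'] [tuple of x :: t])
      = \int[gam n]_t h [tuple of (s * (x - a * x0 / s) + 0) :: lin2 n (- a) s g' t].
      apply: eq_Rintegral => t _.
      by rewrite lin2_cons; congr (h [tuple of _ :: _]); field.
    apply: (IH (fun t => h [tuple of (s * (x - a * x0 / s) + 0) :: t])) => //.
    exact: bmf_cons1.
have e3 : `|a * x0 / s| = `|a * x0| / s by rewrite normrM normfV (gtr0_norm s0).
rewrite -e1 (le_trans tv)// e3; move: e2.
set A := \int[std]_x l _; set B := \int[std]_x _; set S := \sum_(i < n) _.
by move: A B S `|a * x0| s^-1 peak => A B S y t p hE; clear -hE; lra.
Qed.

Lemma sum_min1S n (t x : R) (g : n.-tuple R) :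
  \sum_(i < n.+1) Num.min 1 (t * `|tnth [tuple of x :: g] i|) =
  Num.min 1 (t * `|x|) + \sum_(i < n) Num.min 1 (t * `|tnth g i|).
Proof.
by rewrite big_ord_recl tnth0; under eq_bigr do rewrite tnthS.
Qed.

Lemma bmf_sum_min1 n (t : R) : 0 <= t ->
  bmf (fun g : n.-tuple R => \sum_(i < n) Num.min 1 (t * `|tnth g i|)).
Proof.
move=> t0; elim: (index_enum _) => [|i s IH].
  by under eq_fun do rewrite big_nil; exact: bmf_cst.
under eq_fun do rewrite big_cons.
apply: bmfD => //.
apply: (@bmf_comp _ _ _ _ _ (fun g : n.-tuple R => tnth g i)
  (fun x => Num.min 1 (t * `|x|))); last exact: bmf_min1.
exact: measurable_tnth.
Qed.

Lemma Exp_gauss_abs n (t : R) : 0 <= t ->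
  \int[gam n]_g \sum_(i < n) Num.min 1 (t * `|tnth g i|) <=
  n%:R * (2 * expR 2^-1 * t).
Proof.
move=> t0; elim: n => [|n IH].
  by rewrite gauss_prob0 ?big_ord0 ?mul0r//; exact: bmf_sum_min1.
rewrite gauss_probS; last exact: bmf_sum_min1.
have bS := bmf_sum_min1 n t t0.
rewrite (_ : \int[std]_x _ = \int[std]_x (Num.min 1 (t * `|x|) +
    \int[gam n]_g \sum_(i < n) Num.min 1 (t * `|tnth g i|))); last first.
  apply: eq_Rintegral => x _; under eq_Rintegral do rewrite sum_min1S.
  by rewrite ExpD ?Exp_cst//; exact: bmf_cst.
rewrite ExpD; [|exact: bmf_min1|exact: bmf_cst].
by rewrite Exp_cst -[n.+1%:R]natr1 mulrDl mul1r addrC lerD// Exp_std_abs.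
Qed.

(** Truncation at 1 is subadditive; it turns a sum of [|g_i|] terms into a bounded, hence
    integrable, majorant. *)
Lemma le_sum_min1 n (u : 'I_n -> R) (y : R) : (forall i, 0 <= u i) -> y <= 1 ->
  y <= \sum_i u i -> y <= \sum_i Num.min 1 (u i).
Proof.
move=> u0 y1 yS; apply: (@le_trans _ _ (Num.min 1 (\sum_i u i))).
  by rewrite le_min y1.
suff : Num.min 1 (\sum_i u i) <= \sum_i Num.min 1 (u i) /\ 0 <= \sum_i u i.
  by case.
elim/big_rec2: _ => [|i x z _ [xz z0]]; first by rewrite ge_min lexx orbT.
split; last by rewrite addr_ge0.
have := u0 i; move: xz; rewrite !minEle.
by case: ifP => ?; case: ifP => ?; case: ifP => ?; lra.
Qed.

End NoiseStability.

(** * Oddness, positivity, Cauchy-Schwarz and the linear bound for [F2 f] *)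

Section F2Properties.
Context {R : realType}.
Notation peak := (normal_peak (1 : R)).
Notation gam := (@gauss_prob R).

Variables (d : nat) (f : d.-tuple R -> R).
Hypothesis mf : measurable_fun [set: d.-tuple R] f.
Hypothesis f1 : forall x, -1 <= f x <= 1.
Hypothesis fodd : odd_fun f.

Let bf : bmf f. Proof. exact: bmf_le1. Qed.

Let fN1 x : `|f x| <= 1. Proof. by rewrite ler_norml f1. Qed.

Let co (rho : R) := Num.sqrt (1 - rho ^+ 2).

Let co_ge0 rho : 0 <= co rho. Proof. exact: sqrtr_ge0. Qed.

Let sqr_co rho : 0 <= rho <= 1 -> rho ^+ 2 + co rho ^+ 2 = 1.
Proof.
move=> /andP[r0 r1]; rewrite sqr_sqrtr; first by ring.
by rewrite subr_ge0 expr_le1.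
Qed.

(** The Ornstein-Uhlenbeck operator in Mehler's form, the [P_a] of the overview. *)
Definition noise_op (rho : R) (g : d.-tuple R) : R :=
  \int[gam d]_z f (lin2 d rho (co rho) g z).

Lemma bmf_f_lin2 (a b : R) {dT} {T : measurableType dT} (u v : T -> d.-tuple R) :
  measurable_fun [set: T] u -> measurable_fun [set: T] v ->
  bmf (fun t => f (lin2 d a b (u t) (v t))).
Proof.
by move=> mu_ mv; apply: (fun mh => bmf_comp _ f mh bf);
  exact: measurable_lin2_tuple.
Qed.

Lemma bmf_noise_op rho : bmf (noise_op rho).
Proof.
apply: (bmf_Exp (gam d) (fun p : d.-tuple R * d.-tuple R =>
  f (lin2 d rho (co rho) p.1 p.2))).
exact: bmf_f_lin2.
Qed.

Lemma noise_op_le1 rho g : `|noise_op rho g| <= 1.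
Proof. by apply: Exp_bound => //; apply: bmf_f_lin2. Qed.

Lemma F2E rho : F2 f rho = \int[gam d]_g (f g * noise_op rho g).
Proof.
rewrite /F2.
rewrite (_ : (fun g => _) = fun g => f g * noise_op rho g); last first.
  apply/funext => g; rewrite gauss_expE.
    rewrite ExpZ //; exact: bmf_f_lin2.
  by apply: bmfM; [exact: bmf_cst|exact: bmf_f_lin2].
by rewrite gauss_expE//; apply: bmfM => //; exact: bmf_noise_op.
Qed.

(** The substitution [z |-> -z] negates the whole argument of [f], and [f] is odd. *)
Lemma noise_op_opp rho g :
  \int[gam d]_z f (lin2 d (- rho) (co rho) g z) = - noise_op rho g.
Proof.
rewrite -[LHS](gauss_prob_opp d (fun z => f (lin2 d (- rho) (co rho) g z)));
  last exact: bmf_f_lin2.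
rewrite -ExpN; last exact: bmf_f_lin2.
apply: eq_Rintegral => z _; rewrite -fodd; congr f.
by apply: eq_from_tnth => i; rewrite !(tnth_mktuple, tnth_map); ring.
Qed.

Lemma F2_odd rho : F2 f (- rho) = - F2 f rho.
Proof.
rewrite !F2E -ExpN; last by apply: bmfM => //; exact: bmf_noise_op.
apply: eq_Rintegral => g _; rewrite -mulrN -noise_op_opp; congr (_ * _).
by rewrite /noise_op /co sqrrN.
Qed.

Lemma F2_le1 rho : F2 f rho <= 1.
Proof.
apply: (le_trans (ler_norm _)); rewrite F2E; apply: Exp_bound.
  by apply: bmfM => //; exact: bmf_noise_op.
by move=> g; rewrite normrM mulr_ile1// noise_op_le1.
Qed.

(* If x, y, z are independent standard Gaussian vectors then a x + a' y and
   b x + b' z are (a b)-correlated. *)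
Lemma F2_mulE a b : 0 <= a <= 1 -> 0 <= b <= 1 -> a * b < 1 ->
  F2 f (a * b) = \int[gam d]_x (noise_op a x * noise_op b x).
Proof.
move=> a01 b01 ab1; have /andP[a0 a1] := a01; have /andP[b0 b1] := b01.
have ab0 : 0 <= a * b by rewrite mulr_ge0.
pose r := co (a * b).
have r0 : 0 < r by rewrite sqrtr_gt0 subr_gt0 expr_lt1.
have rn0 : r != 0 by rewrite gt_eqF.
have r2 : r ^+ 2 = 1 - (a * b) ^+ 2.
  by rewrite sqr_sqrtr// subr_ge0 expr_le1// ltW.
have a2 := sqr_co a a01; have b2 := sqr_co b b01.
pose T3 := (d.-tuple R * d.-tuple R * d.-tuple R)%type.
have m11 : measurable_fun [set: T3] (fun q : T3 => q.1.1).
  exact: measurableT_comp.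
have m12 : measurable_fun [set: T3] (fun q : T3 => q.1.2).
  exact: measurableT_comp.
transitivity (\int[gam d]_x \int[gam d]_y \int[gam d]_z
    (f (lin2 d a (co a) x y) * f (lin2 d b (co b) x z))); last first.
  apply: eq_Rintegral => x _; rewrite mulrC -ExpZ; last exact: bmf_f_lin2.
  apply: eq_Rintegral => y _; rewrite mulrC -ExpZ//.
  exact: bmf_f_lin2.
have -> : \int[gam d]_x \int[gam d]_y \int[gam d]_z
      (f (lin2 d a (co a) x y) * f (lin2 d b (co b) x z)) =
    \int[gam d]_z \int[gam d]_x \int[gam d]_y
      (f (lin2 d a (co a) x y) * f (lin2 d b (co b) x z)).
  rewrite -[RHS](Exp_Fubini (gam d) (gam d) (fun p : d.-tuple R * d.-tuple R =>
    \int[gam d]_y (f (lin2 d a (co a) p.1 y) * f (lin2 d b (co b) p.1 p.2)))).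
    apply: eq_Rintegral => x _.
    apply: (Exp_Fubini (gam d) (gam d) (fun p : d.-tuple R * d.-tuple R =>
      f (lin2 d a (co a) x p.1) * f (lin2 d b (co b) x p.2))).
    by apply: bmfM; apply: bmf_f_lin2.
  apply: (bmf_Exp (gam d) (fun q : T3 =>
    f (lin2 d a (co a) q.1.1 q.2) * f (lin2 d b (co b) q.1.1 q.1.2))).
  by apply: bmfM; apply: bmf_f_lin2.
(* The reflection with coefficients [a], [co a] is an involution: from [g = a x + co a y] and
   [w = co a x - a y] one recovers [x = a g + co a w]. *)
pose phi (z : d.-tuple R) (p : d.-tuple R * d.-tuple R) :=
  f p.1 * f (lin2 d b (co b) (lin2 d a (co a) p.1 p.2) z).
have bphi z : bmf (phi z).
  apply: bmfM; first exact: (bmf_comp _ f _ bf).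
  by apply: bmf_f_lin2 => //; exact: measurable_lin2_tuple.
transitivity (\int[gam d]_z \int[gam d]_g \int[gam d]_w phi z (g, w)); last first.
  apply: eq_Rintegral => z _.
  rewrite -[LHS](gauss_prob_rot d (phi z) a (co a) (bphi z) a0 (co_ge0 a) a2).
  apply: eq_Rintegral => x _; apply: eq_Rintegral => y _.
  rewrite /phi /=; congr (_ * f (lin2 d b (co b) _ z)).
  apply: eq_from_tnth => i; rewrite !tnth_mktuple.
  transitivity ((a ^+ 2 + co a ^+ 2) * tnth x i); last by rewrite a2 mul1r.
  by ring.
have -> : \int[gam d]_z \int[gam d]_g \int[gam d]_w phi z (g, w) =
    \int[gam d]_g \int[gam d]_w \int[gam d]_z phi z (g, w).
  rewrite -[LHS](Exp_Fubini (gam d) (gam d) (fun p : d.-tuple R * d.-tuple R =>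
    \int[gam d]_w phi p.2 (p.1, w))).
    apply: eq_Rintegral => g _.
    apply: (Exp_Fubini (gam d) (gam d) (fun p : d.-tuple R * d.-tuple R =>
      phi p.1 (g, p.2))).
    rewrite /phi /=; apply: bmfM; first exact: bmf_cst.
    by apply: bmf_f_lin2 => //; exact: measurable_lin2_tuple.
  apply: (bmf_Exp (gam d) (fun q : T3 => phi q.1.2 (q.1.1, q.2))).
  rewrite /phi /=; apply: bmfM; first exact: (bmf_comp _ f m11 bf).
  by apply: bmf_f_lin2 => //; exact: measurable_lin2_tuple.
rewrite F2E; apply: eq_Rintegral => g _.
(* The second argument is [a b g + (b co a w + co b z)]. The bracket has variance [r^2], and
   rotating [(w, z)] by [(c, s)] makes it [r] times one standard Gaussian vector. *)
pose c := b * co a / r; pose s := co b / r.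
have c0 : 0 <= c by rewrite divr_ge0 ?mulr_ge0 ?(ltW r0).
have s0 : 0 <= s by rewrite divr_ge0 ?(ltW r0).
have cs : c ^+ 2 + s ^+ 2 = 1.
  rewrite !exprMn exprVn -mulrDl r2.
  have -> : b ^+ 2 * co a ^+ 2 + co b ^+ 2 = 1 - (a * b) ^+ 2.
    have -> : co a ^+ 2 = 1 - a ^+ 2 by rewrite -a2; ring.
    have -> : co b ^+ 2 = 1 - b ^+ 2 by rewrite -b2; ring.
    by ring.
  by rewrite divff// -r2 expf_neq0.
have brot : bmf (fun p : d.-tuple R * d.-tuple R => f g * f (lin2 d (a * b) r g p.1)).
  by apply: bmfM; [exact: bmf_cst|exact: bmf_f_lin2].
have := gauss_prob_rot d _ c s brot c0 s0 cs => /= rot.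
transitivity (\int[gam d]_w \int[gam d]_z (f g * f (lin2 d (a * b) r g w))).
  rewrite -ExpZ; last exact: bmf_f_lin2.
  by apply: eq_Rintegral => w _; rewrite Exp_cst.
rewrite -rot; apply: eq_Rintegral => w _; apply: eq_Rintegral => z _.
rewrite /phi /=; congr (_ * f _).
by apply: eq_from_tnth => i; rewrite !tnth_mktuple /c /s; field.
Qed.

Lemma F2_1 : F2 f 1 = \int[gam d]_x (f x * f x).
Proof.
rewrite F2E; apply: eq_Rintegral => x _; congr (_ * _).
rewrite /noise_op /co expr1n subrr sqrtr0.
rewrite (_ : (fun z => _) = fun _ => f x) ?Exp_cst//.
apply/funext => z; congr f; apply: eq_from_tnth => i.
by rewrite tnth_mktuple mul1r mul0r addr0.
Qed.

(** With [a = b = sqrt x], [F2_mulE] gives the integral of a square; the excluded endpoint 1 is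
    [F2_1]. *)
Lemma F2_ge0 x : 0 <= x <= 1 -> 0 <= F2 f x.
Proof.
move=> /andP[x0]; rewrite le_eqVlt => /predU1P[->|x1].
  by rewrite F2_1; apply: Rintegral_ge0 => g _; rewrite -expr2 sqr_ge0.
have s01 : 0 <= Num.sqrt x <= 1.
  by rewrite sqrtr_ge0/= -sqrtr1 ler_sqrt// ltW.
have e : Num.sqrt x * Num.sqrt x = x by rewrite -expr2 sqr_sqrtr.
have := F2_mulE _ _ s01 s01; rewrite e => -> //.
by apply: Rintegral_ge0 => g _; rewrite -expr2 sqr_ge0.
Qed.

(** Cauchy-Schwarz for the functions [noise_op a] and [noise_op b]; [a * b = 1] forces [a = b = 1],
    where both sides agree. *)
Lemma F2_mul a b : 0 <= a <= 1 -> 0 <= b <= 1 ->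
  F2 f (a * b) ^+ 2 <= F2 f (a ^+ 2) * F2 f (b ^+ 2).
Proof.
move=> a01 b01; have /andP[a0 a1] := a01; have /andP[b0 b1] := b01.
have sq x : 0 <= x <= 1 -> F2 f (x ^+ 2) = \int[gam d]_g (noise_op x g * noise_op x g).
  move=> x01; have /andP[x0] := x01; rewrite le_eqVlt => /predU1P[->|x1].
    rewrite expr1n F2_1; apply: eq_Rintegral => g _.
    have -> : noise_op 1 g = f g; last by [].
    rewrite /noise_op /co expr1n subrr sqrtr0.
    rewrite (_ : (fun z => _) = fun _ => f g) ?Exp_cst//.
    apply/funext => z; congr f; apply: eq_from_tnth => i.
    by rewrite tnth_mktuple mul1r mul0r addr0.
  by rewrite expr2 F2_mulE// mulr_ilt1.
have [ab|ab] := ltP (a * b) 1; last first.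
  have a11 : a = 1 by nra.
  have b11 : b = 1 by nra.
  by rewrite a11 b11 mulr1 expr1n.
rewrite (F2_mulE a b a01 b01 ab) (sq a a01) (sq b b01).
apply: Exp_Cauchy_Schwarz; exact: bmf_noise_op.
Qed.

(* f is odd, so noise_op rho g is half its difference with noise_op rho (- g):
   a total-variation distance between two Gaussians at distance O(rho |g|). *)
Lemma noise_op_small rho g : 0 <= rho <= 2^-1 ->
  `|noise_op rho g| <= \sum_(i < d) 4 * peak * rho * `|tnth g i|.
Proof.
move=> /andP[r0 r1].
(* [rho <= 1/2] bounds [1 / co rho] by 2. This factor 2 in [TV] is cancelled by the oddness, which
   makes the difference twice [noise_op rho g]. *)
have c2 : 2^-1 <= co rho.
  have -> : 2^-1 = Num.sqrt ((2^-1 : R) ^+ 2) by rewrite sqrtr_sqr ger0_norm.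
  by rewrite ler_sqrt; nra.
have c0 : 0 < co rho by apply: lt_le_trans c2.
have ic : (co rho)^-1 <= 2 by rewrite -[leRHS]invrK lef_pV2 ?posrE.
have TV a : `|a| = rho -> \int[gam d]_z f (lin2 d a (co rho) g z) <=
    \int[gam d]_z f (lin2 d (- a) (co rho) g z) +
    2 * \sum_(i < d) 4 * peak * rho * `|tnth g i|.
  move=> ea; apply: (le_trans (gauss_prob_TV d f a (co rho) g bf fN1 c0)).
  rewrite lerD2l mulr_sumr [leRHS]mulr_sumr; apply: ler_sum => i _.
  rewrite normrM ea.
  have := ler_wpM2l (mulr_ge0 (mulr_ge0 (normal_peak_ge0 (1 : R)) r0)
    (normr_ge0 (tnth g i))) ic.
  by move: (co rho)^-1 `|tnth g i| peak => u v w; lra.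
have h1 := TV rho (ger0_norm r0).
have h2 := TV (- rho); rewrite normrN opprK in h2.
have {}h2 := h2 (ger0_norm r0).
by rewrite !noise_op_opp -/(noise_op rho g) in h1 h2; rewrite ler_norml; lra.
Qed.

(** For [x <= 1/2] the bound [noise_op_small], truncated at 1, is integrated and gives [C * x]; for
    larger [x], [F2 f x <= 1 <= 2 x]. *)
Lemma F2_lin : exists K, forall x, 0 <= x <= 1 -> F2 f x <= K * x.
Proof.
pose C := d%:R * (2 * expR (2^-1 : R) * (4 * peak)).
have C0 : 0 <= C.
  by rewrite !mulr_ge0 ?expR_ge0 ?normal_peak_ge0.
exists (C + 2) => x /andP[x0 x1].
have [xh|xh] := lerP x 2^-1; last first.
  by apply: (le_trans (F2_le1 x)); nra.
have t0 : 0 <= 4 * peak * x by rewrite !mulr_ge0 ?normal_peak_ge0.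
rewrite F2E; apply: (@le_trans _ _ (C * x)); last by nra.
apply: (@le_trans _ _ (\int[gam d]_g
    \sum_(i < d) Num.min 1 (4 * peak * x * `|tnth g i|))); last first.
  by apply: (le_trans (Exp_gauss_abs d _ t0)); rewrite /C; lra.
apply: le_Exp; [by apply: bmfM => //; exact: bmf_noise_op|exact: bmf_sum_min1|].
move=> g; apply: le_sum_min1.
- by move=> i; rewrite mulr_ge0.
- by apply: (le_trans (ler_norm _)); rewrite normrM mulr_ile1// noise_op_le1.
- apply: (le_trans (ler_norm _)); rewrite normrM.
  apply: (@le_trans _ _ (`|noise_op x g|)).
    by rewrite ler_piMl.
  by apply: noise_op_small; rewrite x0.
Qed.

Lemma F2_convex01 : convex01 (F2 f).
Proof.
have [K FK] := F2_lin.
exact: (F_convex01 _ F2_ge0 F2_mul K FK).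
Qed.

End F2Properties.

(** * Transfer to completeness and performance *)

(** Completeness ([G = id]) and [s3] ([G = F2 f]) are the same decreasing affine function of the
    expected sums, so equal [S] and larger [V] suffice. *)
Lemma fexp_affine (R : realType) (D : fdist R) (G : R -> R) :
  \sum_(x <- D) x.1 = 1 ->
  fexp D (fun b => let '(b12, b13, b23) := b in (3 - G b12 - G b13 - G b23) / 4) =
  (3 - \sum_(x <- D) x.1 * (G x.2.1.1 + G x.2.1.2 + G x.2.2)) / 4.
Proof.
move=> D1.
have -> : 3 - \sum_(x <- D) x.1 * (G x.2.1.1 + G x.2.1.2 + G x.2.2) =
    \sum_(x <- D) x.1 * (3 - (G x.2.1.1 + G x.2.1.2 + G x.2.2)).
  under [RHS]eq_bigr do rewrite mulrBr.
  by rewrite sumrB -mulr_suml D1 mul1r.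
by rewrite /fexp mulr_suml; apply: eq_bigr => -[w [[x y] z]] _ /=; field.
Qed.

Theorem mainTheorem11 (R : realType) (d : nat) (f : d.-tuple R -> R) :
  (0 < d)%N ->
  measurable_fun [set: d.-tuple R] f ->
  (forall x, -1 <= f x <= 1) ->
  odd_fun f ->
  forall D : fdist R, is_fdist_on_P D ->
  exists D' : fdist R,
    [/\ is_fdist_on_P D',
        completeness D' = completeness D,
        s3 f D' <= s3 f D &
        [\/ exists rho : R, 0 <= rho <= 3^-1 /\
              supported_on D' (fun b => b = (-rho, -rho, -rho) \/ b = (-rho, -rho, 1)),
            exists rho : R, 3^-1 <= rho <= 1 /\
              supported_on D' (fun b => b = (-3^-1, -3^-1, -3^-1) \/ b = (-rho, -rho, 1))
          | exists rho : R, -1 <= rho <= 1 /\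
              supported_on D' (fun b => b = (-rho, -rho, 1) \/ b = (1, 1, 1))]].
Proof.
move=> _ mf f1 fodd D [DP D1].
have cvx := F2_convex01 d f mf f1 fodd.
have odd := F2_odd d f mf f1 fodd.
have Fodd x : -1 <= x <= 1 -> F2 f (- x) = - F2 f x by move=> _; exact: odd.
have := dominated_fdist (F2 f) D cvx Fodd DP; rewrite D1.
move=> /(dominated_two_point (F2 f) cvx)[p [q [p0 q0 pq H]]].
(* [D'] is always the two-point distribution with weights [p] and [q], so each form only requires
   comparing sums and values. *)
have two (u v : bias R) : inP u -> inP v ->
    \sum_(x <- D) x.1 * (x.2.1.1 + x.2.1.2 + x.2.2) =
      p * (u.1.1 + u.1.2 + u.2) + q * (v.1.1 + v.1.2 + v.2) ->
    \sum_(x <- D) x.1 * (F2 f x.2.1.1 + F2 f x.2.1.2 + F2 f x.2.2) <=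
      p * (F2 f u.1.1 + F2 f u.1.2 + F2 f u.2) +
      q * (F2 f v.1.1 + F2 f v.1.2 + F2 f v.2) ->
    [/\ is_fdist_on_P [:: (p, u); (q, v)],
      completeness [:: (p, u); (q, v)] = completeness D,
      s3 f [:: (p, u); (q, v)] <= s3 f D &
      supported_on [:: (p, u); (q, v)] (fun b => b = u \/ b = v)].
  move=> uP vP eS leV.
  have D'1 : \sum_(x <- [:: (p, u); (q, v)]) x.1 = 1.
    by rewrite !big_cons big_nil /= addr0.
  split.
  - by split=> // x; rewrite !inE => /orP[] /eqP ->.
  - rewrite /completeness (fexp_affine _ _ id D'1) (fexp_affine _ _ id D1) eS.
    by rewrite !big_cons big_nil /= addr0.
  - rewrite /s3 (fexp_affine _ _ (F2 f) D'1) (fexp_affine _ _ (F2 f) D1).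
    by rewrite ler_pM2r ?invr_gt0// lerD2l lerN2 !big_cons big_nil /= addr0.
  - by move=> x; rewrite !inE => /orP[] /eqP -> _; [left|right].
case: H => [[rho [r01 eS leV]]|[rho [r01 eS leV]]|[rho [r01 eS leV]]].
- have [||||? ? ? ?] := two (- rho, - rho, - rho) (- rho, - rho, 1).
  + by split; lra.
  + by split; lra.
  + by rewrite -eS /=; ring.
  + by rewrite /= !odd; lra.
  exists [:: (p, (- rho, - rho, - rho)); (q, (- rho, - rho, 1))].
  by split=> //; apply: Or31; exists rho.
- have [||||? ? ? ?] := two (- 3^-1, - 3^-1, - 3^-1) (- rho, - rho, 1).
  + by split; lra.
  + by split; lra.
  + by rewrite -eS /=; field.
  + by rewrite /= !odd; lra.
  exists [:: (p, (- 3^-1, - 3^-1, - 3^-1)); (q, (- rho, - rho, 1))].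
  by split=> //; apply: Or32; exists rho.
- have [||||? ? ? ?] := two (- rho, - rho, 1) (1, 1, 1).
  + by split; lra.
  + by split; lra.
  + by rewrite -eS /=; ring.
  + by rewrite /= !odd; lra.
  exists [:: (p, (- rho, - rho, 1)); (q, (1, 1, 1))].
  by split=> //; apply: Or33; exists rho; split=> //; lra.
Qed.
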